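(* Work in the Gaussian white noise model described in the context. Let $\kappa>0$, $L>0$, assume that $\vartheta=L/\kappa>1$ and $\binom{d}{d^*}\ge3$. Let $\gamma_\vartheta$ be the largest (positive) integer $\gamma$ satisfying $\gamma\bigl(1+(h(z_\gamma)-1)^{-1}\bigr)\le\vartheta$ (this integer is used in part (i) only, where it is assumed to exist). (i) If for some $\alpha\in(0,1/2)$, $$\frac{N(d^*,\gamma_\vartheta)\,d^*\log(d/d^* )}{n^2}\ge\frac{\vartheta}{\alpha\gamma_\vartheta}\,\kappa^2,$$ then, for $d^*$ large enough (larger than a threshold depending only on $\kappa,L,\alpha$), $$\inf_{\widetilde J}\sup_{f\in\Sigma(\kappa,L)}\mathbf P_f(\widetilde J\neq J_f)\ge\tfrac12-\alpha.$$ (ii) If for some $\alpha\in(0,1/2)$, $$\frac{d^*\log(d/d^* )}{n}\ge\frac{\kappa}{\alpha},$$ then $$\inf_{\widetilde J}\sup_{f\in\Sigma(\kappa,L)}\mathbf P_f(\widetilde J\neq J_f)\ge\tfrac12-\alpha.$$ In both parts the infimum is over all estimators $\widetilde J$ (measurable functions of the observations with values in the subsets of $\{1,\dots,d\}$).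
   Context: $n\ge1$ and $1\le d^*\le d$ are integers. Fourier basis: for $\mathbf k\in\mathbb Z^d$, $\varphi_{\mathbf 0}\equiv1$, $\varphi_{\mathbf k}(\mathbf x)=\sqrt2\cos(2\pi\mathbf k\cdot\mathbf x)$ if $\mathbf k\in(\mathbb Z^d)_+$ and $\varphi_{\mathbf k}(\mathbf x)=\sqrt2\sin(2\pi\mathbf k\cdot\mathbf x)$ if $-\mathbf k\in(\mathbb Z^d)_+$, where $(\mathbb Z^d)_+$ is the set of $\mathbf k\in\mathbb Z^d\setminus\{0\}$ whose first nonzero coordinate is positive. For $f\in L^2([0,1]^d)$, $\theta_{\mathbf k}[f]=\int_{[0,1]^d}f\varphi_{\mathbf k}$. The class $\Sigma(\kappa,L)$ consists of all $f\in L^2([0,1]^d)$ such that $\sum_{\mathbf k\in\mathbb Z^d}k_j^2\theta_{\mathbf k}[f]^2\le L$ for all $j\in\{1,\dots,d\}$ and such that for some $J=J_f\subset\{1,\dots,d\}$ with $\operatorname{Card}(J_f)=d^*$ (the sparsity pattern of $f$) there is a function $\bar f:\mathbb R^{d^*}\to\mathbb R$ with $f(\mathbf x)=\bar f(\mathbf x_{J_f})$ for all $\mathbf x$ ($\mathbf x_J$ being the subvector of coordinates with index in $J$), and $\sum_{\mathbf k:k_j\neq0}\theta_{\mathbf k}[f]^2\ge\kappa$ for all $j\in J_f$. Gaussian white noise model: under $\mathbf P_f$ one observes a Gaussian process $\{\mathbf Y(\phi):\phi\in L^2([0,1]^d)\}$ with mean $\int f\phi$ and covariance $\operatorname{Cov}(\mathbf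 Y(\phi),\mathbf Y(\phi'))=\frac1n\int\phi\phi'$; equivalently one observes $y_{\mathbf k}=\theta_{\mathbf k}[f]+n^{-1/2}\xi_{\mathbf k}$, $\mathbf k\in\mathbb Z^d$, with $\xi_{\mathbf k}$ i.i.d. $N(0,1)$. For an integer $\ell\ge1$ and $\gamma>0$, $N(\ell,\gamma)=\operatorname{Card}\{\mathbf k\in\mathbb Z^\ell:\|\mathbf k\|_2^2\le\gamma\ell,\ k_1\neq0\}$. The Jacobi $\theta$-function is $h(z)=\sum_{r\in\mathbb Z}z^{r^2}$ for $|z|<1$. For $\gamma>0$, $z_\gamma$ denotes the unique solution in $(0,1)$ of $l_\gamma'(z)=0$, where $l_\gamma(z)=\log h(z)-\gamma\log z$. *)

(* Defs.v *)
From HB Require Import structures.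
From mathcomp Require Import all_boot all_order all_algebra finmap.
From mathcomp Require Import all_classical all_reals all_analysis.

Set Implicit Arguments.
Unset Strict Implicit.
Unset Printing Implicit Defensive.

Import Order.TTheory GRing.Theory Num.Theory.
Import numFieldNormedType.Exports.

Local Open Scope classical_set_scope.
Local Open Scope ring_scope.

Section cube_measure.
Variable R : realType.

Definition tcons (n : nat) (p : measurableTypeR R * n.-tuple R) : n.+1.-tuple R :=
  [tuple of p.1 :: p.2].

Lemma measurable_tcons (n : nat) : 
  measurable_fun [set: measurableTypeR R * n.-tuple R] (@tcons n).
Proof. by apply: measurable_cons; [exact: measurable_fst|exact: measurable_snd]. Qed.

HB.instance Definition _ (n : nat) :=
  isMeasurableFun.Build _ _ _ _ (@tcons n) (@measurable_tcons n).

Definition unif01 : probability (measurableTypeR R) R := uniform_prob (@ltr01 R).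

(* Lebesgue measure on [0,1]^d, as a measure on R^d carried by the cube: the
   d-fold product of Lebesgue measure restricted to [0,1]. *)
Fixpoint cube_measure (d : nat) : probability (d.-tuple R) R :=
  match d with
  | 0%N => \d_([tuple])
  | d'.+1 => distribution (unif01 \x cube_measure d')%E (@tcons d')
  end.

Lemma unif01E (A : set R) : measurable A ->
  unif01 A = lebesgue_measure (A `&` `[0, 1]).
Proof.
move=> mA; rewrite /unif01 /= /uniform_prob integral_uniform_pdf.
rewrite (eq_integral (cst 1%E)) ?integral_cst ?mul1e//; first exact: measurableI.
move=> x; rewrite inE => -[_]; rewrite /= in_itv/= => x01.
by rewrite /uniform_pdf x01 subr0 invr1.
Qed.

Lemma cube_measure_box (d : nat) (A : 'I_d -> set R) :
  (forall i, measurable (A i)) ->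
  cube_measure d [set x | forall i, A i (tnth x i)] =
  (\prod_(i < d) lebesgue_measure (A i `&` `[0%R, 1%R]))%E.
Proof.
elim: d A => [|d IH] A mA.
  by rewrite big_ord0 /= diracE mem_set// => -[].
have mB : measurable [set x : d.-tuple R | forall i, A (lift ord0 i) (tnth x i)].
  rewrite (_ : [set _ | _] =
      \bigcap_(i in [set: 'I_d]) ((@tnth _ R)^~ i @^-1` A (lift ord0 i))).
    apply: fin_bigcap_measurable => // i _; rewrite -[_ @^-1` _]setTI.
    exact: (@measurable_tnth _ R d i).
  by apply/seteqP; split=> [x h i _|x h i]; [exact: (h i)|exact: (h i I)].
rewrite big_ord_recl -(IH (fun i => A (lift ord0 i)))// -unif01E//.
rewrite -product_measure1E//; last exact: (mA ord0).
rewrite /= /distribution /pushforward.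
congr ((unif01 \x cube_measure d)%E _).
apply/seteqP; split=> -[x y] /=.
  by move=> h; split=> [|i]; [have := h ord0|have := h (lift ord0 i); rewrite tnthS].
by move=> [Ax Ay] i; case: (unliftP ord0 i) => [j|] ->; rewrite ?tnthS//.
Qed.

End cube_measure.

Section model.
Variable R : realType.

Definition in_cube (d : nat) (x : d.-tuple R) : Prop :=
  forall i : 'I_d, 0 <= tnth x i <= 1.

Definition dotZ (d : nat) (k : {ffun 'I_d -> int}) (x : d.-tuple R) : R :=
  \sum_(i < d) (k i)%:~R * tnth x i.

(* (Z^d)_+ *)
Definition Zplus (d : nat) (k : {ffun 'I_d -> int}) : bool :=
  [exists i : 'I_d, (0 < k i) && [forall j : 'I_d, (j < i)%N ==> (k j == 0)]].

(* For k <> 0, exactly one of k and -k belongs to (Z^d)_+. *)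
Definition fourier_basis (d : nat) (k : {ffun 'I_d -> int}) (x : d.-tuple R) : R :=
  if k == 0 then 1
  else if Zplus k then Num.sqrt 2 * cos (2 * pi * dotZ k x)
  else Num.sqrt 2 * sin (2 * pi * dotZ k x).

Definition theta (d : nat) (k : {ffun 'I_d -> int}) (f : d.-tuple R -> R) : R :=
  \int[cube_measure R d]_(x in setT) (f x * fourier_basis k x).

Definition subvector (d : nat) (J : {set 'I_d}) (x : d.-tuple R) : #|J|.-tuple R :=
  [tuple tnth x (enum_val i) | i < #|J|].

Definition is_sparsity_pattern (d dstar : nat) (kappa : R)
    (f : d.-tuple R -> R) (J : {set 'I_d}) : Prop :=
  [/\ #|J| = dstar,
      exists fbar : #|J|.-tuple R -> R,
        forall x, in_cube x -> f x = fbar (subvector J x)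
    & forall j, j \in J ->
        (kappa%:E <= \esum_(k in [set k : {ffun 'I_d -> int} | (k j != 0)%R])
                       (theta k f ^+ 2)%:E)%E].

(* Functions on [0,1]^d are represented by functions on R^d whose values
   outside the cube are irrelevant. *)
Definition Sigma_class (d dstar : nat) (kappa L : R) : set (d.-tuple R -> R) :=
  [set f | [/\ f \in Lfun (cube_measure R d) 2%:E,
      forall j : 'I_d,
        (\esum_(k in [set: {ffun 'I_d -> int}])
           ((k j)%:~R ^+ 2 * theta k f ^+ 2)%:E <= L%:E)%E
    & exists J, is_sparsity_pattern dstar kappa f J]].

(* J_f.  For 0 < kappa the pattern is unique when it exists: if f depends only
   on x_J, then theta k f = 0 as soon as k j <> 0 for some j outside J. *)
Definition sparsity_pattern (d dstar : nat) (kappa : R) (f : d.-tuple R -> R) :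
    {set 'I_d} :=
  xget (@finset.set0 'I_d) [set J | is_sparsity_pattern dstar kappa f J].

Definition mutually_independent (dO : measure_display) (Omega : measurableType dO)
    (P : probability Omega R) (I : choiceType) (X : I -> {RV P >-> R}) : Prop :=
  forall (s : {fset I}) (B : I -> set R), (forall i, measurable (B i)) ->
    P (\bigcap_(i in [set` s]) (X i @^-1` B i)) =
    (\prod_(i <- s) P (X i @^-1` B i))%E.

Definition iid_standard_normal (dO : measure_display) (Omega : measurableType dO)
    (P : probability Omega R) (I : choiceType) (X : I -> {RV P >-> R}) : Prop :=
  (forall (i : I) (B : set R), measurable B ->
     distribution P (X i) B = normal_prob 0 1 B) /\
  mutually_independent X.

(* The observation (y_k)_k in R^(Z^d) when the signal is f. *)
Definition observation (d n : nat) (dO : measure_display) (Omega : measurableType dO)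
    (P : probability Omega R) (xi : {ffun 'I_d -> int} -> {RV P >-> R})
    (f : d.-tuple R -> R) (w : Omega) : {ffun 'I_d -> int} -> R :=
  fun k => theta k f + (Num.sqrt n%:R)^-1 * xi k w.

(* Generators of the product sigma-algebra of R^(Z^d). *)
Definition coordinate_sets (d : nat) : set (set ({ffun 'I_d -> int} -> R)) :=
  [set C | exists (k : {ffun 'I_d -> int}) (B : set R),
     measurable B /\ C = [set y | B (y k)]].

Definition is_estimator (d : nat) (Jt : ({ffun 'I_d -> int} -> R) -> {set 'I_d}) :
    Prop :=
  forall A : set {set 'I_d}, <<s coordinate_sets (d := d) >> (Jt @^-1` A).

(* P_f (Jt <> J_f), P_f being the law of the observation under P. *)
Definition error_prob (d dstar n : nat) (kappa : R)
    (dO : measure_display) (Omega : measurableType dO)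
    (P : probability Omega R) (xi : {ffun 'I_d -> int} -> {RV P >-> R})
    (Jt : ({ffun 'I_d -> int} -> R) -> {set 'I_d}) (f : d.-tuple R -> R) : \bar R :=
  P [set w | Jt (observation n xi f w) != sparsity_pattern dstar kappa f].

Definition minimax_error (d dstar n : nat) (kappa L : R)
    (dO : measure_display) (Omega : measurableType dO)
    (P : probability Omega R) (xi : {ffun 'I_d -> int} -> {RV P >-> R}) : \bar R :=
  ereal_inf [set ereal_sup [set error_prob dstar n kappa xi Jt f
                           | f in Sigma_class dstar kappa L]
            | Jt in [set Jt | is_estimator Jt]].

(* The set counted here is finite, so that fset_set has its elements. *)
Definition lattice_count (l : nat) (gamma : R) : nat :=
  #|` fset_set [set k : {ffun 'I_l -> int} |
        \sum_(i < l) (k i)%:~R ^+ 2 <= gamma * l%:R /\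
        exists i : 'I_l, (i = 0 :> nat)%N /\ k i <> 0]|%fset.

(* sum_(r in Z) z ^ (r ^ 2) as the limit of its symmetric partial sums; the
   series converges absolutely for `|z| < 1. *)
Definition jacobi_theta (z : R) : R :=
  limn (fun N : nat => \sum_(i < N.*2.+1) z ^+ (`|i%:Z - N%:Z|%N ^ 2)).

Definition l_gamma (gamma z : R) : R := ln (jacobi_theta z) - gamma * ln z.

Definition z_gamma (gamma : R) : R :=
  xget 0 [set z : R | 0 < z < 1 /\ derive1 (l_gamma gamma) z = 0].

Definition gamma_admissible (vartheta : R) (gamma : nat) : Prop :=
  (0 < gamma)%N /\
  gamma%:R * (1 + (jacobi_theta (z_gamma gamma%:R) - 1)^-1) <= vartheta.

Definition is_gamma_vartheta (vartheta : R) (gamma : nat) : Prop :=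
  gamma_admissible vartheta gamma /\
  forall g : nat, gamma_admissible vartheta g -> (g <= gamma)%N.

End model.

(* Main.v *)
(**
Reduction to testing. Under the zero signal, a prior on signals with sparsity
pattern J has a likelihood ratio L_J of mean 1. If E (L_J ^ 2) <= N ^ alpha for all
the N = 'C(d, dstar) patterns, a variant of Fano's lemma shows that some pattern is
missed with probability at least 1/2 - alpha.

In part (ii) the prior is the single signal sqrt kappa * phi_k with k the indicator
of J, for which E (L_J ^ 2) = exp (n * kappa).

In part (i) the prior puts independent random signs on coefficients of common size
A = sqrt (kappa / m), indexed by a permutation-invariant finite set F of frequencies
carried by J, m being the number of k in F with k_j <> 0. Then
E (L_J ^ 2) = cosh (n * A ^ 2) ^ #|F|, so it suffices that F satisfies the moment
constraint sum_F k_j ^ 2 <= vartheta * m and that 2 * #|F| * N(dstar, gamma) <= m ^ 2.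
One has N(dstar, gamma) <= (h(z) * z ^ (- gamma)) ^ dstar at z = z_gamma, and
ln h(z) - gamma * ln z is the entropy of the law proportional to z ^ (r ^ 2) on Z,
whose second moment is gamma because l_gamma'(z) = 0. The condition defining
gamma_vartheta is exactly the moment constraint for this law. Moving a little mass
from 0 to {-1, 1} makes the moment constraint strict and, at the same time, strictly
increases the entropy; hence the set of typical vectors of the modified law is
exponentially larger than N(dstar, gamma), which absorbs all polynomial losses and
makes exact asymptotics of N(dstar, gamma) unnecessary.
*)

Require Import Defs.
From HB Require Import structures.
From mathcomp Require Import all_boot all_order all_algebra finmap.
From mathcomp Require Import all_classical all_reals all_analysis.
From mathcomp Require Import measurable_realfun perm ring lra zify.

Set Implicit Arguments.
Unset Strict Implicit.
Unset Printing Implicit Defensive.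

Import Order.TTheory GRing.Theory Num.Theory.
Import numFieldNormedType.Exports.

Local Open Scope classical_set_scope.
Local Open Scope ring_scope.

(** * Gaussian white noise and change of measure *)

Section density.
Local Open Scope ereal_scope.
Context dT (T : measurableType dT) (R : realType).
Variables (nu mu : {measure set T -> \bar R}) (g : T -> R).
Hypothesis mg : measurable_fun setT g.
Hypothesis g0 : forall x, (0 <= g x)%R.
Hypothesis nuE : forall A, measurable A -> nu A = \int[mu]_(x in A) (g x)%:E.

Import HBNNSimple.

Let integral_density_nnsfun (f : {nnsfun T >-> R}) :
  \int[nu]_x (f x)%:E = \int[mu]_x ((f x)%:E * (g x)%:E).
Proof.
under [LHS]eq_integral do rewrite fimfunE -fsumEFin//.
rewrite [LHS]ge0_integral_fsum//; last 2 first.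
  - by move=> r; exact/measurable_EFinP/measurableT_comp.
  - by move=> n x _; rewrite EFinM nnfun_muleindic_ge0.
under [RHS]eq_integral.
  move=> x xD; rewrite fimfunE -fsumEFin// ge0_mule_fsuml; last first.
    by move=> r; rewrite EFinM nnfun_muleindic_ge0.
  over.
rewrite [RHS]ge0_integral_fsum//; last 2 first.
  - move=> r; apply: emeasurable_funM; last exact/measurable_EFinP.
    by apply/measurable_EFinP; do 2 apply/measurableT_comp => //.
  - move=> n x _; rewrite EFinM mule_ge0//; last by rewrite lee_fin.
    by rewrite nnfun_muleindic_ge0.
apply: eq_fsbigr => r _.
rewrite integralZl_indic_nnsfun//= integral_indic// setIT nuE//.
have [r0|r0] := ltP r 0%R.
  rewrite preimage_nnfun0// integral_set0 mule0.
  by rewrite integral0_eq// => x _; rewrite indicE in_set0 mulr0 mul0e.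
rewrite integral_mkcond -ge0_integralZl//.
- apply: eq_integral => x _; rewrite patchE indicE.
  by case: ifPn => _ /=; rewrite ?mulr1 ?EFinM ?mul0e ?mule0 ?mul0e.
- apply/(measurable_restrictT _ _).1 => //.
  exact/measurable_EFinP/measurable_funTS.
- by move=> x _; rewrite patchE; case: ifPn => // _; rewrite lee_fin.
Qed.

(** Proved for simple functions first, then extended by monotone convergence along [nnsfun_approx],
    applied once for [nu] and once for [mu]. *)
Lemma ge0_integral_density (f : T -> \bar R) : measurable_fun setT f ->
  (forall x, 0 <= f x) -> \int[nu]_x f x = \int[mu]_x (f x * (g x)%:E).
Proof.
move=> mf f0.
pose f_ := nnsfun_approx measurableT mf.
transitivity (lim (\int[nu]_x (f_ n x)%:E @[n --> \oo])).
  rewrite -monotone_convergence//=.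
  - apply: eq_integral => ? /[!inE] xD; apply/esym/cvg_lim => //=.
    exact: cvg_nnsfun_approx.
  - by move=> n; apply/measurable_EFinP/measurable_funTS.
  - by move=> n x _; rewrite lee_fin.
  - by move=> x _ a b ab; rewrite lee_fin; exact/lefP/nd_nnsfun_approx.
transitivity (lim (\int[mu]_x ((f_ n x)%:E * (g x)%:E) @[n --> \oo])).
  by congr (lim (_ @ \oo)); apply/funext => n; exact: integral_density_nnsfun.
rewrite -monotone_convergence//=.
- apply: eq_integral => x /[!inE] xD; apply/cvg_lim => //=.
  by apply: cvgeZr => //; exact: cvg_nnsfun_approx.
- move=> n; apply: emeasurable_funM; apply/measurable_EFinP => //.
- by move=> n x _; rewrite mule_ge0// lee_fin.
- move=> x _ a b ab; rewrite lee_wpmul2r ?lee_fin//.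
  exact/lefP/nd_nnsfun_approx.
Qed.

End density.

(** * Translation of a one-dimensional Gaussian *)

Section normal_shift.
Local Open Scope ereal_scope.
Variable R : realType.
Local Notation mu := (@lebesgue_measure R).

Let shift (t : R) (x : measurableTypeR R) : measurableTypeR R := (x + t)%R.

Let mshift (t : R) : measurable_fun setT (shift t).
Proof. exact: measurable_funD. Qed.

HB.instance Definition _ (t : R) :=
  isMeasurableFun.Build _ _ _ _ (shift t) (mshift t).

Lemma lebesgue_measure_shift (t : R) (A : set (measurableTypeR R)) :
  measurable A -> mu ((fun x => x + t)%R @^-1` A) = mu A.
Proof.
move=> mA; rewrite -[LHS]/(pushforward mu (shift t) A).
apply/esym/(@lebesgue_measure_unique _ (pushforward mu (shift t))) => //= _ [[a b]] _ <-.
rewrite /pushforward /shift (_ : _ @^-1` _ = `](a - t)%R, (b - t)%R]%classic); last first.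
  apply/seteqP; split=> x /=; rewrite !in_itv/=; lra.
rewrite !lebesgue_measure_itv/= !lte_fin ltrD2r.
by case: ifPn => // _; rewrite -!EFinD; congr EFin; lra.
Qed.

Lemma ge0_integral_shift (t : R) (f : measurableTypeR R -> \bar R) :
  measurable_fun setT f -> (forall x, 0 <= f x) ->
  \int[mu]_x f (x + t)%R = \int[mu]_x f x.
Proof.
move=> mf f0.
have := @ge0_integral_pushforward _ _ _ _ R _ (mshift t) mu setT f measurableT mf.
rewrite preimage_setT => <- //.
by apply: eq_measure_integral => A mA _; exact: lebesgue_measure_shift.
Qed.

Lemma ge0_integral_normal (m s : R) (f : measurableTypeR R -> \bar R) :
  measurable_fun setT f -> (forall x, 0 <= f x) ->
  \int[normal_prob m s]_x f x = \int[mu]_x (f x * (normal_pdf m s x)%:E).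
Proof.
move=> mf f0; apply: ge0_integral_density => //.
- exact: measurable_normal_pdf.
- exact: normal_pdf_ge0.
Qed.

(** The Cameron-Martin formula in dimension one. Lebesgue measure is translation invariant, and
    completing the square turns the density at [x + t] times the weight at [x + t] into the density
    at [x]. *)
Lemma ge0_integral_normal_shift (t : R) (f : measurableTypeR R -> \bar R) :
  measurable_fun setT f -> (forall x, 0 <= f x) ->
  \int[normal_prob 0 1]_x f (x + t)%R =
  \int[normal_prob 0 1]_x (f x * (expR (t * x - t ^+ 2 / 2))%:E).
Proof.
move=> mf f0.
rewrite ge0_integral_normal//; last exact: (measurableT_comp mf (mshift t)).
rewrite ge0_integral_normal//; last 2 first.
  - apply: emeasurable_funM => //; apply/measurable_EFinP/measurableT_comp => //.
    apply: measurable_funB => //; exact: measurable_funM.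
  - by move=> x; rewrite mule_ge0// lee_fin expR_ge0.
rewrite -[RHS](@ge0_integral_shift t); first last.
- by move=> x; rewrite !mule_ge0// lee_fin ?expR_ge0 ?normal_pdf_ge0.
- apply: emeasurable_funM; last by apply/measurable_EFinP; exact: measurable_normal_pdf.
  apply: emeasurable_funM => //; apply/measurable_EFinP/measurableT_comp => //.
  apply: measurable_funB => //; exact: measurable_funM.
apply: eq_integral => x _; rewrite -muleA -EFinM; congr (_ * _%:E).
rewrite normal_pdfE ?oner_neq0//= mulrCA; congr (_ * _)%R.
rewrite /normal_fun -expRD; congr expR.
rewrite !subr0 expr1n; lra.
Qed.

End normal_shift.

(** * The product sigma-algebra on real families indexed by the frequencies *)

Section sequence_space.
Variables (R : realType) (d : nat).
Local Notation I := {ffun 'I_d -> int}.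
Local Notation T := (g_sigma_algebraType (@coordinate_sets R d)).

Lemma measurable_coordinate (k : I) : measurable_fun [set: T] (fun y : T => y k).
Proof.
move=> _ B mB; rewrite setTI; apply: sub_sigma_algebra.
by exists k, B; split.
Qed.

Lemma measurable_to_sequence dS (S : measurableType dS) (f : S -> T) :
  (forall k, measurable_fun setT (fun x => f x k)) -> measurable_fun setT f.
Proof.
move=> mf; apply: (@measurability _ _ _ _ _ f (@coordinate_sets R d)) => //.
move=> _ [_ [k [B [mB ->]]] <-].
by rewrite setTI -[X in measurable X]setTI; exact: mf.
Qed.

(** A generator stable under intersection on which mutual independence determines the law of the
    noise; measures agreeing on it can then be identified. *)
Definition cylinders : set (set T) :=
  [set C | exists (s : {fset I}) (B : I -> set R), (forall i, measurable (B i)) /\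
     C = [set y | forall i, i \in s -> B i (y i)]].

Lemma cylinders_setI : setI_closed cylinders.
Proof.
move=> _ _ [s1 [B1 [mB1 ->]]] [s2 [B2 [mB2 ->]]].
exists (s1 `|` s2)%fset, (fun i =>
  (if i \in s1 then B1 i else setT) `&` (if i \in s2 then B2 i else setT)); split.
  by move=> i; apply: measurableI; case: ifP.
apply/seteqP; split=> y /=.
  move=> [h1 h2] i _; split; case: ifP => //.
    exact: h1.
  exact: h2.
move=> h; split=> i is_.
  by have := h i; rewrite inE is_ => /(_ isT) [].
by have := h i; rewrite inE is_ orbT => /(_ isT) [].
Qed.

Lemma measurable_cylinders : @measurable _ T = <<s cylinders >>.
Proof.
apply/seteqP; split.
  apply: smallest_sub; first exact: smallest_sigma_algebra.
  move=> _ [k [B [mB ->]]]; apply: sub_sigma_algebra.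
  exists [fset k]%fset, (fun=> B); split=> //.
  apply/seteqP; split=> y /=; first by move=> yB i; rewrite inE => /eqP ->.
  by move=> h; apply: h; rewrite inE.
apply: smallest_sub; first exact: sigma_algebra_measurable.
move=> _ [s [B [mB ->]]].
have -> : [set y : T | forall i, i \in s -> B i (y i)] =
    \bigcap_(i in [set` s]) [set y | B i (y i)].
  by apply/seteqP; split=> y /=.
apply: fin_bigcap_measurable => // i _.
by rewrite -[X in measurable X]setTI; exact: measurable_coordinate.
Qed.

Definition update (k : I) (p : measurableTypeR R * T) : T :=
  fun j => if j == k then p.1 else p.2 j.

Lemma measurable_update (k : I) : measurable_fun setT (update k).
Proof.
apply: measurable_to_sequence => j; rewrite /update.
case: (j == k); first exact: measurable_fst.
exact: measurableT_comp (measurable_coordinate j) measurable_snd.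
Qed.

HB.instance Definition _ (k : I) :=
  isMeasurableFun.Build _ _ _ _ (update k) (measurable_update k).

End sequence_space.

(** * Shifting finitely many coordinates of the noise *)

Section white_noise.
Local Open Scope ereal_scope.
Variables (R : realType) (d : nat).
Local Notation I := {ffun 'I_d -> int}.
Local Notation T := (g_sigma_algebraType (@coordinate_sets R d)).
Context (dO : measure_display) (Omega : measurableType dO) (P : probability Omega R).
Variable (xi : I -> {RV P >-> R}).
Hypothesis xi_iid : iid_standard_normal xi.

Definition noise (w : Omega) : T := fun k => xi k w.

Lemma measurable_noise : measurable_fun setT noise.
Proof. by apply: measurable_to_sequence => k; exact: measurable_funP. Qed.

HB.instance Definition _ :=
  isMeasurableFun.Build _ _ _ _ noise measurable_noise.

Lemma noise_cylinder (s : {fset I}) (B : I -> set R) :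
  (forall i, measurable (B i)) ->
  distribution P noise [set y | forall i, i \in s -> B i (y i)] =
  \prod_(i <- s) normal_prob 0 1 (B i).
Proof.
move=> mB; rewrite /distribution /pushforward.
have := xi_iid.2 s B mB.
have -> : \bigcap_(i in [set` s]) (xi i @^-1` B i) =
    noise @^-1` [set y | forall i, i \in s -> B i (y i)].
  by apply/seteqP; split=> w /=.
by move=> ->; apply: eq_bigr => i _; exact: (xi_iid.1 i (B i) (mB i)).
Qed.

(* Redrawing a coordinate independently leaves the law of the noise unchanged;
   Tonelli then reduces a shift of that coordinate to one dimension. *)
Lemma noise_resample (k : I) (A : set T) : measurable A ->
  distribution P noise A =
  distribution (normal_prob 0 1 \x distribution P noise) (update k) A.
Proof.
move=> mA.
apply: (measure_unique (@cylinders R d) (fun=> setT)) mA => //.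
- exact: measurable_cylinders.
- exact: cylinders_setI.
- by move=> _; exists fset0, (fun=> setT); split=> //; apply/seteqP; split.
- by rewrite bigcup_const//.
- move=> _ [s [B [mB ->]]].
  (* The preimage of a cylinder is a rectangle: [Bk] constrains the fresh draw, being everything if
     [k] is not in [s], and [s'] keeps the constraints on the old noise. *)
  pose s' := (s `\ k)%fset; pose Bk := if k \in s then B k else setT.
  have mBk : measurable Bk by rewrite /Bk; case: ifP.
  rewrite -[RHS]/((normal_prob 0 1 \x distribution P noise)
    (update k @^-1` [set y | forall i, i \in s -> B i (y i)])).
  have -> : update k @^-1` [set y | forall i, i \in s -> B i (y i)] =
      Bk `*` [set y : T | forall i, i \in s' -> B i (y i)].
    apply/seteqP; split=> -[x y] /=.
      move=> h; split.
        by rewrite /Bk; case: ifP => // ks; have := h _ ks; rewrite /update eqxx.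
      move=> i; rewrite /s' !inE => /andP[ik is_].
      by have := h _ is_; rewrite /update (negbTE ik).
    move=> [xB h] i is_; rewrite /update; have [ik|ik] := eqVneq i k.
      by move: xB; rewrite /Bk -ik is_.
    by apply: h; rewrite /s' !inE ik.
  rewrite [RHS]product_measure1E//; last first.
    rewrite measurable_cylinders; apply: sub_sigma_algebra.
    by exists s', B.
  rewrite [X in _ * X]noise_cylinder// [LHS]noise_cylinder// /Bk /s'.
  case: ifPn => ks; first by rewrite (big_fsetD1 k ks).
  rewrite [X in X * _](_ : _ = 1) ?mul1e; last exact: probability_setT.
  by rewrite mem_fsetD1.
- by move=> _; rewrite -ge0_fin_numE// fin_num_measure.
Qed.

(** After resampling coordinate [k], the integral over the fresh normal variable is innermost, so
    [ge0_integral_normal_shift] applies with all other coordinates frozen. *)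
Lemma noise_shift1 (k : I) (t : R) (f : T -> \bar R) :
  measurable_fun setT f -> (forall y, 0 <= f y) ->
  \int[P]_w f (fun j => if j == k then (xi k w + t)%R else xi j w) =
  \int[P]_w (f (noise w) * (expR (t * xi k w - t ^+ 2 / 2))%:E).
Proof.
move=> mf f0.
pose sh (y : T) : T := fun j => if j == k then (y k + t)%R else y j.
have msh : measurable_fun setT sh.
  apply: measurable_to_sequence => j; rewrite /sh.
  case: (j == k); last exact: measurable_coordinate.
  by apply: measurable_funD => //; exact: measurable_coordinate.
have resample (g : T -> \bar R) : measurable_fun setT g -> (forall y, 0 <= g y) ->
    \int[P]_w g (noise w) =
    \int[distribution P noise]_y \int[normal_prob 0 1]_x g (update k (x, y)).
  move=> mg g0.
  rewrite -[LHS](@ge0_integral_distribution _ _ _ _ _ _ noise g)//.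
  rewrite -[RHS](@fubini_tonelli2 _ _ _ _ _ (normal_prob 0 1) (distribution P noise)
    (g \o update k)); [|exact: (measurableT_comp mg (measurable_update k))|by move=> y /=].
  rewrite -[RHS](@ge0_integral_distribution _ _ _ _ _ _ (update k) g)//.
  by apply: eq_measure_integral => A mA _; exact: noise_resample.
rewrite -[LHS]/(\int[P]_w (f \o sh) (noise w)).
rewrite resample; [|exact: (measurableT_comp mf msh)|by move=> y /=].
pose g (y : T) := f y * (expR (t * y k - t ^+ 2 / 2))%:E.
rewrite -[RHS]/(\int[P]_w g (noise w)) resample//; last 2 first.
- apply: emeasurable_funM => //; apply/measurable_EFinP/measurableT_comp => //.
  apply: measurable_funB => //; apply: measurable_funM => //.
  exact: measurable_coordinate.
- by move=> y; rewrite mule_ge0// lee_fin expR_ge0.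
apply: eq_integral => y _.
have mfu : measurable_fun setT (fun x : measurableTypeR R => f (update k (x, y))).
  apply: (measurableT_comp mf).
  by apply: (measurableT_comp (measurable_update k)); exact: measurable_pair2.
rewrite (eq_integral (fun x : measurableTypeR R => f (update k (x + t, y)%R))); last first.
  move=> x _; congr f; apply/funext => j; rewrite /update /sh /=.
  by rewrite eqxx; case: (j == k).
have := ge0_integral_normal_shift t mfu (fun=> f0 _) => /=.
move=> ->.
by apply: eq_integral => x _; rewrite /g /update /= eqxx.
Qed.

Lemma noise_shift (s : seq I) (c : I -> R) (f : T -> \bar R) : uniq s ->
  measurable_fun setT f -> (forall y, 0 <= f y) ->
  \int[P]_w f (fun j => (xi j w + if j \in s then c j else 0)%R) =
  \int[P]_w (f (noise w) * (expR (\sum_(k <- s) (c k * xi k w - c k ^+ 2 / 2)))%:E).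
Proof.
elim: s f => [|k s IH] f /= us mf f0.
  apply: eq_integral => w _; rewrite big_nil expR0 mule1; congr f.
  by apply/funext => j; rewrite addr0.
case/andP: us => ks us.
pose sh (y : T) : T := fun j => if j == k then (y k + c k)%R else y j.
have msh : measurable_fun setT sh.
  apply: measurable_to_sequence => j; rewrite /sh.
  case: (j == k); last exact: measurable_coordinate.
  by apply: measurable_funD => //; exact: measurable_coordinate.
rewrite (eq_integral (fun w => (f \o sh)
    (fun j => (xi j w + if j \in s then c j else 0)%R))); last first.
  move=> w _ /=; congr f; apply/funext => j; rewrite /sh inE.
  by have [->|] //= := eqVneq j k; rewrite (negbTE ks) addr0.
rewrite IH; [|exact: us|exact: (measurableT_comp mf msh)|by move=> y /=].
pose g (y : T) := f y * (expR (\sum_(k <- s) (c k * y k - c k ^+ 2 / 2)))%:E.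
(* The weight already produced involves only coordinates in [s], which [sh] leaves alone because [k]
   is not in [s]; it can be moved inside the shift. *)
rewrite (eq_integral (fun w => g (sh (noise w)))); last first.
  move=> w _; rewrite /g /=; congr (_ * (expR _)%:E).
  apply: eq_big_seq => j js; rewrite /sh /noise.
  by have [jk|//] := eqVneq j k; move: ks; rewrite -jk js.
have mg : measurable_fun setT g.
  apply: emeasurable_funM => //; apply/measurable_EFinP/measurableT_comp => //.
  apply: measurable_sum => j; apply: measurable_funB => //.
  by apply: measurable_funM => //; exact: measurable_coordinate.
rewrite [LHS](noise_shift1 k (c k) mg)//; last first.
  by move=> y; rewrite mule_ge0// lee_fin expR_ge0.
apply: eq_integral => w _; rewrite /g -muleA -EFinM -expRD big_cons.
by congr (_ * (expR _)%:E); rewrite addrC.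
Qed.

End white_noise.

(** * A second-moment version of Fano's lemma *)

Section fano.
Context (R : realType) (dO : measure_display) (Omega : measurableType dO).
Variable P : probability Omega R.

(** The bound [1 + x <= expR x] at [y - ln l] and at [ln l - K], multiplied by [l] and added: the
    terms in [l * ln l] cancel. In the Fenchel-Young inequality for the entropy this trades the
    entropy for a second moment, and [l ^+ 2 * expR (- K)] has mean at most 1 as soon as the second
    moment of [l] is at most [expR K]. *)
Lemma fenchel_second_moment (l y K : R) : 0 < l ->
  l * (y - K) <= l ^+ 2 * expR (- K) - 2 * l + expR y.
Proof.
move=> l0.
have h1 := expR_ge1Dx (y - ln l).
have h2 := expR_ge1Dx (ln l - K).
have e1 : l * expR (y - ln l) = expR y.
  by rewrite expRD expRN lnK// mulrCA divff ?gt_eqF// mulr1.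
have e2 : l * expR (ln l - K) = l ^+ 2 * expR (- K).
  by rewrite expRD lnK// mulrA.
rewrite -e1 -e2.
have /ler_wpM2l : 0 <= l by exact: ltW.
move=> hl; have := hl _ _ h1; have := hl _ _ h2; lra.
Qed.

(** Equivalent to [(2 - 1 / N) ^ 2 <= N]. For [N >= 4] the left side is below 4, and for [N = 3] it
    is 25/9. It fails at [N = 2], whence the requirement of three patterns. *)
Lemma ln_fano_le (N : nat) : (3 <= N)%N ->
  ln ((2 * N%:R - 1) / N%:R : R) <= ln N%:R / 2.
Proof.
move=> N3; have N0 : 0 < N%:R :> R by rewrite ltr0n (leq_trans _ N3).
have N3R : 3 <= N%:R :> R by rewrite (ler_nat R 3).
set x := _ / _; have x0 : 0 < x by rewrite divr_gt0//; lra.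
have -> : ln x = ln (x ^+ 2) / 2 by rewrite lnXn// mulr2n; lra.
rewrite ler_pM2r ?invr_gt0// ler_ln ?posrE ?exprn_gt0//.
rewrite /x expr_div_n ler_pdivrMr ?exprn_gt0//.
have [N4|] := leqP 4 N.
  have : 4 <= N%:R :> R by rewrite (ler_nat R 4).
  move: (N%:R) N0 => n n0 n4; nra.
rewrite ltnS => N3'; have -> : N = 3%N by apply/eqP; rewrite eqn_leq N3 N3'.
by lra.
Qed.

(* Integrate fenchel_second_moment with y = ln N * 1_A - c, K = alpha * ln N and
   c = ln (2 - 1 / N), then average over the N disjoint events A. *)
Lemma fano_second_moment (J : finType) (S : {set J}) (alpha : R)
    (L : J -> Omega -> R) (phi : Omega -> J) :
  0 <= alpha -> (3 <= #|S|)%N ->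
  (forall j, measurable (phi @^-1` [set j])) ->
  (forall j, measurable_fun setT (L j)) -> (forall j w, 0 < L j w) ->
  (forall j, j \in S -> (\int[P]_w (L j w)%:E = 1)%E) ->
  (forall j, j \in S ->
     (\int[P]_w (L j w ^+ 2)%:E <= (expR (alpha * ln #|S|%:R))%:E)%E) ->
  exists2 j, j \in S &
    (\int[P]_(w in phi @^-1` [set j]) (L j w)%:E <= (1 / 2 + alpha)%:E)%E.
Proof.
move=> a0 N3 mphi mL L0 L1 L2.
set N := #|S| in N3 L2 *.
have N0 : 0 < N%:R :> R by rewrite ltr0n (leq_trans _ N3).
have N3R : 3 <= N%:R :> R by rewrite (ler_nat R 3).
pose A j := phi @^-1` [set j].
have mA j : measurable (A j) by exact: mphi.
pose la := ln (N%:R : R); pose K := alpha * la.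
pose c := ln ((2 * N%:R - 1) / N%:R : R).
have la0 : 0 < la by rewrite ln_gt0//; lra.
have K0 : 0 <= K by rewrite mulr_ge0// ltW.
have r1 : 1 <= (2 * N%:R - 1) / N%:R :> R by rewrite ler_pdivlMr//; lra.
have c0 : 0 <= c by rewrite ln_ge0.
have ec : expR (- c) = N%:R / (2 * N%:R - 1).
  by rewrite expRN lnK ?invf_div// posrE (lt_le_trans _ r1).
pose q j := fine (P (A j)).
have qE j : P (A j) = (q j)%:E by rewrite fineK// fin_num_measure.
have sumq : \sum_(j in S) q j <= 1.
  rewrite -lee_fin -sumEFin.
  under eq_bigr do rewrite -qE.
  rewrite -big_enum fsbig_seq ?enum_uniq// -measure_fin_bigcup//.
    by apply: probability_le1; exact: fin_bigcup_measurable.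
  by move=> i j _ _ [w [<- <-]].
pose p j := (\int[P]_(w in A j) (L j w)%:E)%E.
have p0 j : (0 <= p j)%E by apply: integral_ge0 => w _; rewrite lee_fin ltW.
have pS j : j \in S -> (p j <= 1)%E.
  move=> jS; rewrite -(L1 _ jS); apply: ge0_subset_integral => //.
    exact/measurable_EFinP.
  by move=> w _; rewrite lee_fin ltW.
have pE j : j \in S -> p j = (fine (p j))%:E.
  by move=> jS; rewrite fineK// ge0_fin_numE// (le_lt_trans (pS _ jS))// ltry.
(* The integrated Fenchel inequality: the summand 1 bounds the second-moment term, the next one is
   the mean of [expR (la * \1_(A j) - c)], while 2 and [c + K] are multiplied by the mean of [L j],
   which is 1. *)
have key j : j \in S -> la * fine (p j) + 2 <=
    1 + expR (- c) * (1 + (N%:R - 1) * q j) + (c + K).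
  move=> jS.
  have pw w : la * (L j w * \1_(A j) w) + 2 * L j w <=
      L j w ^+ 2 * expR (- K) + expR (- c) * (1 + (N%:R - 1) * \1_(A j) w)
        + (c + K) * L j w.
    have := fenchel_second_moment (la * \1_(A j) w - c) K (L0 j w).
    rewrite expRD [expR (- c) * _]mulrC.
    rewrite indicE; case: (_ \in _); rewrite /= ?mulr1 ?mulr0 ?addr0.
      rewrite lnK ?posrE// => h; nra.
    rewrite expR0 => h; nra.
  have mI : measurable_fun setT (\1_(A j) : Omega -> R) by exact: measurable_indic.
  have Lge0 w : 0 <= L j w by exact: ltW.
  have m1 : measurable_fun setT (fun w => L j w * \1_(A j) w) by exact: measurable_funM.
  have m2 : measurable_fun setT (fun w => L j w ^+ 2) by exact: measurable_funX.
  have m3 : measurable_fun setT (fun w => 1 + (N%:R - 1) * \1_(A j) w : R).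
    by apply: measurable_funD => //; apply: measurable_funM.
  have g3 w : 0 <= 1 + (N%:R - 1) * \1_(A j) w :> R.
    by rewrite indicE; case: (_ \in _); rewrite /= ?mulr1 ?mulr0; lra.
  have g1 w : 0 <= L j w * \1_(A j) w by rewrite mulr_ge0.
  have le12 : (\int[P]_w (la * (L j w * \1_(A j) w) + 2 * L j w)%:E <=
      \int[P]_w (L j w ^+ 2 * expR (- K) +
        expR (- c) * (1 + (N%:R - 1) * \1_(A j) w) + (c + K) * L j w)%:E)%E.
    apply: ge0_le_integral => //.
    - move=> w _; rewrite lee_fin addr_ge0// mulr_ge0//; exact: ltW.
    - apply/measurable_EFinP/measurable_funD; exact: measurable_funM.
    - apply/measurable_EFinP/measurable_funD; last exact: measurable_funM.
      by apply: measurable_funD; exact: measurable_funM.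
    - by move=> w _; rewrite lee_fin.
  have i1 : (\int[P]_w (la * (L j w * \1_(A j) w) + 2 * L j w)%:E =
      (la * fine (p j) + 2)%:E)%E.
    rewrite (eq_integral (fun w =>
      la%:E * (L j w * \1_(A j) w)%:E + 2%:E * (L j w)%:E)%E); last first.
      by move=> w _; rewrite -!EFinM -EFinD.
    rewrite ge0_integralD//; last 4 first.
    - by move=> w _; rewrite mule_ge0// lee_fin// ltW.
    - by apply: emeasurable_funM => //; apply/measurable_EFinP.
    - by move=> w _; rewrite mule_ge0// lee_fin.
    - by apply: emeasurable_funM => //; apply/measurable_EFinP.
    rewrite ge0_integralZl_EFin//; last 3 first.
    - by move=> w _; rewrite lee_fin.
    - exact/measurable_EFinP.
    - exact: ltW.
    rewrite ge0_integralZl_EFin//; last 2 first.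
    - by move=> w _; rewrite lee_fin.
    - exact/measurable_EFinP.
    rewrite L1// mule1 [RHS]EFinD [X in _ = (X + _)%E]EFinM -pE// /p; congr (_ * _ + _)%E.
    rewrite [RHS]integral_mkcond; apply: eq_integral => w _.
    by rewrite patchE indicE; case: (_ \in _); rewrite /= ?mulr1 ?mulr0.
  have i2 : (\int[P]_w (L j w ^+ 2 * expR (- K) +
      expR (- c) * (1 + (N%:R - 1) * \1_(A j) w) + (c + K) * L j w)%:E <=
      (1 + expR (- c) * (1 + (N%:R - 1) * q j) + (c + K))%:E)%E.
    rewrite (eq_integral (fun w => (L j w ^+ 2)%:E * (expR (- K))%:E +
      (expR (- c))%:E * (1 + (N%:R - 1) * \1_(A j) w)%:E +
      (c + K)%:E * (L j w)%:E)%E); last by move=> w _; rewrite -!EFinM -!EFinD.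
    rewrite ge0_integralD//; last 4 first.
    - by move=> w _; rewrite adde_ge0// mule_ge0// lee_fin// ?expR_ge0// sqr_ge0.
    - apply: emeasurable_funD; apply: emeasurable_funM => //; exact/measurable_EFinP.
    - by move=> w _; rewrite mule_ge0// lee_fin// addr_ge0.
    - by apply: emeasurable_funM => //; apply/measurable_EFinP.
    rewrite ge0_integralD//; last 3 first.
    - by move=> w _; rewrite mule_ge0// lee_fin// ?expR_ge0// sqr_ge0.
    - by apply: emeasurable_funM => //; apply/measurable_EFinP.
    - by apply: emeasurable_funM => //; apply/measurable_EFinP.
    rewrite ge0_integralZr; [|by []|exact/measurable_EFinP
      |by move=> w _; rewrite lee_fin sqr_ge0|by rewrite lee_fin expR_ge0].
    rewrite ge0_integralZl_EFin; [|by []|by move=> w _; rewrite lee_fin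
      |exact/measurable_EFinP|exact: expR_ge0].
    rewrite [X in (_ + X)%E]ge0_integralZl_EFin; [|by []|by move=> w _; rewrite lee_fin
      |exact/measurable_EFinP|by rewrite addr_ge0].
    rewrite L1// mule1.
    have -> : (\int[P]_w (1 + (N%:R - 1) * \1_(A j) w)%:E =
        (1 + (N%:R - 1) * q j)%:E)%E.
      rewrite (eq_integral (fun w => 1%:E + (N%:R - 1)%:E * (\1_(A j) w)%:E)%E);
        last by move=> w _; rewrite -!EFinM -!EFinD.
      rewrite ge0_integralD//; last 2 first.
      - by move=> w _; rewrite mule_ge0// lee_fin; lra.
      - by apply: emeasurable_funM => //; apply/measurable_EFinP.
      rewrite ge0_integralZl_EFin; [|by []|by move=> w _; rewrite lee_fin
        |exact/measurable_EFinP|lra].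
      rewrite integral_indic// setIT.
      rewrite [RHS]EFinD [X in _ = (_ + X)%E]EFinM; congr (_ + _ * _)%E; last exact: qE.
      by rewrite integral_cst// mul1e; exact: probability_setT.
    rewrite !EFinD EFinM; apply: leeD => //; apply: leeD => //.
    apply: (le_trans (lee_wpmul2r _ (L2 _ jS))); first by rewrite lee_fin expR_ge0.
    by rewrite -EFinM lee_fin -expRD subrr expR0.
  by move: le12; rewrite i1 => /le_trans /(_ i2); rewrite lee_fin.
apply: contrapT => hn.
have big j : j \in S -> 1 / 2 + alpha < fine (p j).
  move=> jS; rewrite -lte_fin -pE// ltNge; apply/negP => h; apply: hn; by exists j.
have S0 : (0 < #|S|)%N by rewrite (leq_trans _ N3).
have sump : (1 / 2 + alpha) * N%:R < \sum_(j in S) fine (p j).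
  rewrite mulr_natr -[X in X < _]sumr_const; apply: ltr_sum => //.
  by move: S0; rewrite card_gt0 => /set0Pn[j jS]; apply/hasP; exists j => //; exact: mem_index_enum.
have tot : la * (\sum_(j in S) fine (p j)) + 2 * N%:R <=
    N%:R + expR (- c) * (N%:R + (N%:R - 1) * \sum_(j in S) q j) + (c + K) * N%:R.
  have lin (a b : R) (g : J -> R) :
      \sum_(j in S) (a * g j + b) = a * (\sum_(j in S) g j) + b * N%:R.
    by rewrite big_split /= -mulr_sumr sumr_const mulr_natr.
  have -> : N%:R + expR (- c) * (N%:R + (N%:R - 1) * \sum_(j in S) q j) + (c + K) * N%:R =
      (expR (- c) * (N%:R - 1)) * (\sum_(j in S) q j) + (1 + expR (- c) + (c + K)) * N%:R.
    by ring.
  by rewrite -!lin; apply: ler_sum => j /key; rewrite !mulrDr !mulrDl; lra.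
have cle := ln_fano_le N3; rewrite -/c -/la in cle.
(* The value of [c] is chosen so that, the [q j] summing to at most 1, the exponential terms average
   to at most 1. The constants in [tot] then cancel and leave [(c + K) * N%:R], where [c] is at most
   half of [la]. *)
have e2 : expR (- c) * (N%:R + (N%:R - 1) * \sum_(j in S) q j) <= N%:R.
  rewrite ec mulrAC ler_pdivrMr; last lra.
  by apply: ler_wpM2l; [exact: ltW|nra].
have : la * ((1 / 2 + alpha) * N%:R) < la * \sum_(j in S) fine (p j).
  by rewrite ltr_pM2l.
suff : (c + K) * N%:R <= la * ((1 / 2 + alpha) * N%:R) by lra.
by rewrite mulrA ler_pM2r// /K; lra.
Qed.

End fano.

(** * Fourier basis and signals with finitely many frequencies *)

Lemma bounded_integrable d (T : measurableType d) (R : realType)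
    (P : probability T R) (f : T -> R) (M : R) :
  measurable_fun setT f -> (forall x, `|f x| <= M) ->
  P.-integrable setT (EFin \o f).
Proof.
move=> mf fM; apply: measurable_bounded_integrable => //.
  by apply: (@le_lt_trans _ _ 1%E); [exact: probability_le1|exact: ltry].
exists M; split; first exact: num_real.
by move=> N MN x _; exact: le_trans (fM x) (ltW MN).
Qed.

Lemma Rintegral_prodM d1 d2 (T1 : measurableType d1) (T2 : measurableType d2)
    (R : realType) (P1 : probability T1 R) (P2 : probability T2 R)
    (a : T1 -> R) (b : T2 -> R) (A B : R) :
  measurable_fun setT a -> measurable_fun setT b ->
  (forall x, `|a x| <= A) -> (forall y, `|b y| <= B) ->
  \int[(P1 \x P2)%E]_z (a z.1 * b z.2) = (\int[P1]_x a x) * (\int[P2]_y b y).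
Proof.
move=> ma mb aA bB.
have ia := bounded_integrable P1 ma aA.
have ib := bounded_integrable P2 mb bB.
have mab : measurable_fun setT (fun z : T1 * T2 => a z.1 * b z.2).
  apply: measurable_funM; first exact: measurableT_comp measurable_fst.
  exact: measurableT_comp measurable_snd.
have iab : (P1 \x P2)%E.-integrable setT (EFin \o (fun z : T1 * T2 => a z.1 * b z.2)).
  apply: (@bounded_integrable _ _ _ (P1 \x P2)%E _ (A * B)) => // z.
  by rewrite normrM ler_pM.
rewrite {1}/Rintegral -(integral12_prod_meas1 iab) /=.
rewrite /fubini_F /=.
under eq_integral.
  move=> x _; under eq_integral do rewrite EFinM.
  rewrite integralZl//.
  over.
rewrite /=.
have -> : (\int[P2]_y (b y)%:E = (\int[P2]_y b y)%:E)%E.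
  by rewrite /Rintegral fineK// integrable_fin_num.
rewrite integralZr//= fineM ?integrable_fin_num//.
Qed.

Section fourier.
Variable R : realType.

Lemma cos_sin_int (m : int) :
  cos (2 * pi * m%:~R) = 1 :> R /\ sin (2 * pi * m%:~R) = 0 :> R.
Proof.
have nat_case (n : nat) : cos (2 * pi * n%:R) = 1 :> R /\ sin (2 * pi * n%:R) = 0 :> R.
  have -> : 2 * pi * n%:R = 0 + pi *+ 2 *+ n :> R.
    by rewrite add0r -mulr_natr -[pi *+ 2]mulr_natr; ring.
  rewrite (periodicn (@cosD2pi R)) (periodicn (@sinD2pi R)).
  by rewrite cos0 sin0.
case: m => n; first exact: nat_case.
have [h1 h2] := nat_case n.+1.
by rewrite NegzE mulrNz mulrN cosN sinN h1 h2 oppr0.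
Qed.

Lemma continuous_cosM (a : R) : continuous (fun x => cos (a * x)).
Proof.
move=> x; apply: continuous_comp; last exact: continuous_cos.
exact: mulrl_continuous.
Qed.

Lemma continuous_sinM (a : R) : continuous (fun x => sin (a * x)).
Proof.
move=> x; apply: continuous_comp; last exact: continuous_sin.
exact: mulrl_continuous.
Qed.

(** The fundamental theorem of calculus is applied to [1 + f], which is nonnegative since [f] is
    bounded by 1, with primitive [x + F x]; the constant is subtracted afterwards. *)
Lemma unif01_FTC (f F : R -> R) :
  continuous f -> (forall x : R, is_derive x (1 : R) F (f x)) -> (forall x, `|f x| <= 1) ->
  \int[unif01 R]_x f x = F 1 - F 0.
Proof.
move=> cf dF f1.
have mf : measurable_fun [set: measurableTypeR R] f by exact: continuous_measurable_fun.
have i1 : (unif01 R).-integrable setT (EFin \o f) by exact: bounded_integrable mf f1.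
have key : \int[unif01 R]_x (1 + f x) = 1 + (F 1 - F 0).
  rewrite /Rintegral (@integral_uniform _ _ _ ltr01); last 2 first.
    by apply/measurable_EFinP; exact: measurable_funD.
    move=> x; rewrite lee_fin; have := f1 x; rewrite ler_norml => /andP[]; lra.
  rewrite subr0 invr1 mul1e.
  have dG (x : R) : is_derive x (1 : R) (fun x : R => x + F x) (1 + f x).
    exact: is_deriveD.
  have cG (x : R) : {for x, continuous (fun x : R => x + F x)}.
    by apply/differentiable_continuous/derivable1_diffP; exact: ex_derive.
  rewrite (@continuous_FTC2 _ _ (fun x => x + F x))//.
  - by rewrite -EFinB /=; ring.
  - apply: continuous_subspaceT => x; apply: cvgD; [exact: cvg_cst|exact: cf].
  - split.
    + by move=> x _; exact: ex_derive.
    + by apply: cvg_at_right_filter; exact: cG.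
    + by apply: cvg_at_left_filter; exact: cG.
  - by move=> x _; rewrite derive1E; exact: derive_val.
move: key; rewrite RintegralD//; last first.
  exact: finite_measure_integrable_cst.
rewrite Rintegral_cst// => /eqP.
rewrite (_ : fine _ = 1) ?mulr1; last exact: (congr1 fine (probability_setT _)).
by move=> /eqP; lra.
Qed.

Lemma unif01_cos (m : int) : \int[unif01 R]_x cos (2 * pi * (m%:~R * x)) = (m == 0)%:R.
Proof.
have [->|m0] := eqVneq m 0.
  under eq_Rintegral do rewrite mul0r mulr0 cos0.
  rewrite Rintegral_cst// mul1r; exact: (congr1 fine (probability_setT _)).
pose a : R := 2 * pi * m%:~R.
have a0 : a != 0.
  by rewrite !mulf_neq0// ?intr_eq0// gt_eqF// pi_gt0.
under eq_Rintegral do rewrite mulrA -/a.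
have [c1 s1] := cos_sin_int m; rewrite -/a in c1 s1.
have dF (x : R) : is_derive x (1 : R) (fun x : R => a^-1 * sin (a * x)) (cos (a * x)).
  by apply: is_derive_eq; rewrite /GRing.scale /=; field.
rewrite (unif01_FTC (@continuous_cosM a) dF).
  by rewrite mulr1 mulr0 sin0 s1 !mulr0 subrr.
by move=> x; rewrite ler_norml cos_geN1 cos_le1.
Qed.

Lemma unif01_sin (m : int) : \int[unif01 R]_x sin (2 * pi * (m%:~R * x)) = 0.
Proof.
have [->|m0] := eqVneq m 0.
  under eq_Rintegral do rewrite mul0r mulr0 sin0.
  by rewrite Rintegral_cst// mul0r.
pose a : R := 2 * pi * m%:~R.
have a0 : a != 0.
  by rewrite !mulf_neq0// ?intr_eq0// gt_eqF// pi_gt0.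
under eq_Rintegral do rewrite mulrA -/a.
have [c1 s1] := cos_sin_int m; rewrite -/a in c1 s1.
have dF (x : R) : is_derive x (1 : R) (fun x : R => - a^-1 * cos (a * x)) (sin (a * x)).
  by apply: is_derive_eq; rewrite /GRing.scale /=; field.
rewrite (unif01_FTC (@continuous_sinM a) dF).
  by rewrite mulr1 mulr0 cos0 c1 subrr.
by move=> x; rewrite ler_norml sin_geN1 sin_le1.
Qed.

End fourier.

(** * Orthonormality of the Fourier basis on the cube *)

Section orthonormality.
Variable R : realType.

Lemma measurable_dotZ d (k : {ffun 'I_d -> int}) :
  measurable_fun setT (@dotZ R d k).
Proof.
apply: measurable_sum => i; apply: measurable_funM => //.
exact: (@measurable_tnth _ R d i).
Qed.

Lemma dotZD d (k l : {ffun 'I_d -> int}) (x : d.-tuple R) :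
  dotZ (k + l) x = dotZ k x + dotZ l x.
Proof.
by rewrite /dotZ -big_split /=; apply: eq_bigr => i _; rewrite ffunE intrD mulrDl.
Qed.

Lemma dotZN d (k : {ffun 'I_d -> int}) (x : d.-tuple R) : dotZ (- k) x = - dotZ k x.
Proof.
by rewrite /dotZ -sumrN; apply: eq_bigr => i _; rewrite ffunE mulrNz mulNr.
Qed.

Definition cosk d (k : {ffun 'I_d -> int}) (x : d.-tuple R) : R :=
  cos (2 * pi * dotZ k x).
Definition sink d (k : {ffun 'I_d -> int}) (x : d.-tuple R) : R :=
  sin (2 * pi * dotZ k x).

Lemma measurable_phase d (k : {ffun 'I_d -> int}) :
  measurable_fun setT (fun x : d.-tuple R => 2 * pi * dotZ k x).
Proof. by apply: measurable_funM => //; exact: measurable_dotZ. Qed.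

Lemma measurable_cosk d (k : {ffun 'I_d -> int}) : measurable_fun setT (cosk k).
Proof.
apply: measurableT_comp (measurable_phase k).
exact: continuous_measurable_fun (@continuous_cos R).
Qed.

Lemma measurable_sink d (k : {ffun 'I_d -> int}) : measurable_fun setT (sink k).
Proof.
apply: measurableT_comp (measurable_phase k).
exact: continuous_measurable_fun (@continuous_sin R).
Qed.

Lemma normr_cos_le1 (x : R) : `|cos x| <= 1.
Proof. by rewrite ler_norml cos_geN1 cos_le1. Qed.

Lemma normr_sin_le1 (x : R) : `|sin x| <= 1.
Proof. by rewrite ler_norml sin_geN1 sin_le1. Qed.

Lemma integrable_cosk d (k : {ffun 'I_d -> int}) :
  (cube_measure R d).-integrable setT (EFin \o cosk k).
Proof.
by apply: bounded_integrable (measurable_cosk k) _ => x; exact: normr_cos_le1.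
Qed.

Lemma integrable_sink d (k : {ffun 'I_d -> int}) :
  (cube_measure R d).-integrable setT (EFin \o sink k).
Proof.
by apply: bounded_integrable (measurable_sink k) _ => x; exact: normr_sin_le1.
Qed.

Lemma Rintegral_cubeS d (g : d.+1.-tuple R -> R) (M : R) :
  measurable_fun setT g -> (forall x, `|g x| <= M) ->
  \int[cube_measure R d.+1]_x g x =
  \int[(unif01 R \x cube_measure R d)%E]_p g (tcons p).
Proof.
move=> mg gM; rewrite /Rintegral /=; congr fine.
rewrite integral_distribution//; first exact/measurable_EFinP.
apply: (@bounded_integrable _ _ _ (unif01 R \x cube_measure R d)%E (g \o @tcons R d) M).
  exact: measurableT_comp mg (@measurable_tcons R d).
by move=> x; exact: gM.
Qed.

Definition tailk d (k : {ffun 'I_d.+1 -> int}) : {ffun 'I_d -> int} :=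
  [ffun i => k (lift ord0 i)].

Lemma dotZ_tcons d (k : {ffun 'I_d.+1 -> int}) p :
  dotZ k (tcons p) = (k ord0)%:~R * p.1 + dotZ (tailk k) p.2 :> R.
Proof.
rewrite /dotZ big_ord_recl; congr (_ + _); apply: eq_bigr => i _.
by rewrite ffunE tnthS.
Qed.

Lemma tailk_eq0 d (k : {ffun 'I_d.+1 -> int}) :
  (k == 0) = (k ord0 == 0) && (tailk k == 0).
Proof.
apply/eqP/andP => [->|[/eqP k0 /eqP kt]].
  by split; apply/eqP; [rewrite ffunE|apply/ffunP => i; rewrite !ffunE].
apply/ffunP => i; rewrite [RHS]ffunE; have [j ->|->//] := unliftP ord0 i.
by have := congr1 (fun f : {ffun 'I_d -> int} => f j) kt; rewrite /= !ffunE.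
Qed.

(** Induction on the dimension: the addition formulas split off the first coordinate and Fubini
    factors each product. Cosine and sine are treated together because each addition formula
    involves both. *)
Lemma Rintegral_cosk_sink d (k : {ffun 'I_d -> int}) :
  \int[cube_measure R d]_x cosk k x = (k == 0)%:R /\
  \int[cube_measure R d]_x sink k x = 0.
Proof.
elim: d k => [|d IH] k.
  have -> : k = 0 by apply/ffunP => -[].
  rewrite eqxx /cosk /sink; split.
    under eq_Rintegral do rewrite /dotZ big_ord0 mulr0 cos0.
    by rewrite Rintegral_cst// mul1r; exact: (congr1 fine (probability_setT _)).
  under eq_Rintegral do rewrite /dotZ big_ord0 mulr0 sin0.
  by rewrite Rintegral_cst// mul0r.
have [C S] := IH (tailk k).
pose c0 (x : measurableTypeR R) : R := cos (2 * pi * ((k ord0)%:~R * x)).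
pose s0 (x : measurableTypeR R) : R := sin (2 * pi * ((k ord0)%:~R * x)).
have mphase : measurable_fun setT (fun x : measurableTypeR R => 2 * pi * ((k ord0)%:~R * x)).
  by do 2 apply: measurable_funM => //.
have mc0 : measurable_fun setT c0.
  by apply: measurableT_comp mphase; exact: continuous_measurable_fun (@continuous_cos R).
have ms0 : measurable_fun setT s0.
  by apply: measurableT_comp mphase; exact: continuous_measurable_fun (@continuous_sin R).
have c01 x : `|c0 x| <= 1 by exact: normr_cos_le1.
have s01 x : `|s0 x| <= 1 by exact: normr_sin_le1.
have ct1 x : `|cosk (tailk k) x| <= 1 by exact: normr_cos_le1.
have st1 x : `|sink (tailk k) x| <= 1 by exact: normr_sin_le1.
have ip (a : measurableTypeR R -> R) (b : d.-tuple R -> R) :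
    measurable_fun setT a -> measurable_fun setT b ->
    (forall x, `|a x| <= 1) -> (forall x, `|b x| <= 1) ->
    (unif01 R \x cube_measure R d)%E.-integrable setT
      (EFin \o (fun p : measurableTypeR R * d.-tuple R => a p.1 * b p.2)).
  move=> ma mb a1 b1.
  apply: (@bounded_integrable _ _ _ (unif01 R \x cube_measure R d)%E _ (1 * 1)).
    apply: measurable_funM; first exact: measurableT_comp measurable_fst.
    exact: measurableT_comp measurable_snd.
  by move=> p; rewrite normrM ler_pM.
have mct := measurable_cosk (tailk k). have mst := measurable_sink (tailk k).
split.
  rewrite (Rintegral_cubeS (measurable_cosk k) (fun x => normr_cos_le1 _)).
  under eq_Rintegral do rewrite /cosk dotZ_tcons mulrDr cosD.
  rewrite RintegralB//; [|exact: (ip _ _ mc0 mct)|exact: (ip _ _ ms0 mst)].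
  rewrite (Rintegral_prodM _ _ mc0 mct c01 ct1) (Rintegral_prodM _ _ ms0 mst s01 st1).
  rewrite C S unif01_cos unif01_sin mul0r subr0 tailk_eq0.
  by rewrite -natrM mulnb.
rewrite (Rintegral_cubeS (measurable_sink k) (fun x => normr_sin_le1 _)).
under eq_Rintegral do rewrite /sink dotZ_tcons mulrDr sinD.
rewrite RintegralD//; [|exact: (ip _ _ ms0 mct)|exact: (ip _ _ mc0 mst)].
rewrite (Rintegral_prodM _ _ ms0 mct s01 ct1) (Rintegral_prodM _ _ mc0 mst c01 st1).
by rewrite S unif01_sin mul0r mulr0 addr0.
Qed.

(** Compare the first nonzero coordinates of [k] and [l]. If their positions differ, the earlier one
    survives in the sum; if they coincide, two positive numbers are added. *)
Lemma Zplus_addr_neq0 d (k l : {ffun 'I_d -> int}) : Zplus k -> Zplus l -> k + l != 0.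
Proof.
move=> /existsP[i /andP[ki /forallP kz]] /existsP[i' /andP[li /forallP lz]].
apply/eqP => kl0.
have kl j : k j + l j = 0.
  by have := congr1 (fun f : {ffun 'I_d -> int} => f j) kl0; rewrite /= !ffunE.
have [ii'|i'i|/val_inj ii'] := ltngtP i i'.
- have := lz i; rewrite ii' /= => /eqP li0; have := kl i; rewrite li0 addr0 => ki0.
  by rewrite ki0 ltxx in ki.
- have := kz i'; rewrite i'i /= => /eqP ki0; have := kl i'; rewrite ki0 add0r => li0.
  by rewrite li0 ltxx in li.
- by have := kl i; rewrite {2}ii' => /eqP; rewrite gt_eqF// addr_gt0.
Qed.

Lemma Zplus_total d (k : {ffun 'I_d -> int}) : k != 0 -> Zplus k || Zplus (- k).
Proof.
move=> k0.
have [i0 ki0] : exists i, k i != 0.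
  apply/existsP; apply: contraR k0; rewrite negb_exists => /forallP h.
  by apply/eqP/ffunP => i; rewrite ffunE; apply/eqP; have := h i; rewrite negbK.
pose i := [arg min_(j < i0 | k j != 0) (j : nat)].
have [ki imin] : k i != 0 /\ forall j, k j != 0 -> (i <= j)%N.
  by rewrite /i; case: arg_minnP.
have kz (j : 'I_d) : (j < i)%N -> k j = 0.
  by move=> ji; apply/eqP; apply: contraLR ji => /imin; rewrite -leqNgt.
have [kpos|kneg] : 0 < k i \/ 0 < - k i by rewrite oppr_gt0; case: ltgtP ki; auto.
  apply/orP; left; apply/existsP; exists i; rewrite kpos /=.
  by apply/forallP => j; apply/implyP => /kz ->.
apply/orP; right; apply/existsP; exists i; rewrite ffunE kneg /=.
by apply/forallP => j; apply/implyP => /kz kj; rewrite ffunE kj oppr0.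
Qed.

Lemma measurable_fourier_basis d (k : {ffun 'I_d -> int}) :
  measurable_fun setT (@fourier_basis R d k).
Proof.
rewrite /fourier_basis; case: (k == 0); first exact: measurable_cst.
by case: (Zplus k); apply: measurable_funM => //;
  [exact: measurable_cosk|exact: measurable_sink].
Qed.

Lemma normr_fourier_basis_le d (k : {ffun 'I_d -> int}) (x : d.-tuple R) :
  `|fourier_basis k x| <= 2.
Proof.
have s2 : Num.sqrt 2 <= 2 :> R.
  by rewrite -[X in _ <= X]ger0_norm// -sqrtr_sqr ler_wsqrtr//; lra.
rewrite /fourier_basis; case: (k == 0); first by rewrite normr1; lra.
case: (Zplus k); rewrite normrM (ger0_norm (sqrtr_ge0 _)).
  have := normr_cos_le1 (2 * pi * dotZ k x); have := normr_ge0 (cos (2 * pi * dotZ k x)).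
  have := sqrtr_ge0 (2 : R); nra.
have := normr_sin_le1 (2 * pi * dotZ k x); have := normr_ge0 (sin (2 * pi * dotZ k x)).
have := sqrtr_ge0 (2 : R); nra.
Qed.

(** Product-to-sum formulas reduce the integral to frequencies [k - l] and [k + l]. Mixed products
    give only sines, which integrate to 0. For two cosines or two sines [k + l] is nonzero, so only
    the term at [k - l] can contribute. *)
Lemma fourier_basis_orthonormal d (k l : {ffun 'I_d -> int}) :
  \int[cube_measure R d]_x (fourier_basis k x * fourier_basis l x) = (k == l)%:R.
Proof.
have ss : Num.sqrt 2 * Num.sqrt 2 = 2 :> R by rewrite -expr2 sqr_sqrtr.
have ic := @integrable_cosk d; have is_ := @integrable_sink d.
have Cd (m : {ffun 'I_d -> int}) := (Rintegral_cosk_sink m).1.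
have Sd (m : {ffun 'I_d -> int}) := (Rintegral_cosk_sink m).2.
have fE (m : {ffun 'I_d -> int}) : @fourier_basis R d m = fun x =>
    if m == 0 then 1 else if Zplus m then Num.sqrt 2 * cosk m x
    else Num.sqrt 2 * sink m x by [].
rewrite !fE.
have [->|k0] := eqVneq k 0.
  have [l0|l0] := eqVneq l 0.
    under eq_Rintegral do rewrite mulr1.
    by rewrite Rintegral_cst// mul1r; exact: (congr1 fine (probability_setT _)).
  under eq_Rintegral do rewrite mul1r.
  case: (Zplus l); first by rewrite (RintegralZl _ measurableT (ic l)) Cd (negbTE l0) mulr0.
  by rewrite (RintegralZl _ measurableT (is_ l)) Sd mulr0.
have [->|l0] := eqVneq l 0.
  under eq_Rintegral do rewrite mulr1.
  rewrite (negbTE k0).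
  case: (Zplus k); first by rewrite (RintegralZl _ measurableT (ic k)) Cd (negbTE k0) mulr0.
  by rewrite (RintegralZl _ measurableT (is_ k)) Sd mulr0.
have subE (x : d.-tuple R) : dotZ (k - l) x = dotZ k x - dotZ l x.
  by rewrite dotZD dotZN.
have neq0 : (Zplus k == Zplus l) -> (k + l == 0) = false.
  move=> /eqP kl; apply/negbTE; case Zk: (Zplus k); first by apply: Zplus_addr_neq0; rewrite // -kl.
  have Zk' : Zplus (- k) by have := Zplus_total k0; rewrite Zk.
  have Zl' : Zplus (- l) by have := Zplus_total l0; rewrite -kl Zk.
  by rewrite -oppr_eq0 opprD Zplus_addr_neq0.
case Zk: (Zplus k); case Zl: (Zplus l).
- rewrite (@eq_Rintegral _ _ _ _ _ (fun x => cosk (k - l) x + cosk (k + l) x)); last first.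
    move=> x _; rewrite /cosk /sink subE dotZD mulrBr (mulrDr (2 * pi)) cosB cosD mulrACA ss; ring.
  by rewrite RintegralD// !Cd neq0 ?Zk ?Zl// addr0 subr_eq0.
- rewrite (@eq_Rintegral _ _ _ _ _ (fun x => sink (k + l) x - sink (k - l) x)); last first.
    move=> x _; rewrite /cosk /sink subE dotZD mulrBr (mulrDr (2 * pi)) sinB sinD mulrACA ss; ring.
  rewrite RintegralB// !Sd subrr.
  by have [kl|//] := eqVneq k l; move: Zl; rewrite -kl Zk.
- rewrite (@eq_Rintegral _ _ _ _ _ (fun x => sink (k + l) x + sink (k - l) x)); last first.
    move=> x _; rewrite /cosk /sink subE dotZD mulrBr (mulrDr (2 * pi)) sinB sinD mulrACA ss; ring.
  rewrite RintegralD// !Sd addr0.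
  by have [kl|//] := eqVneq k l; move: Zl; rewrite -kl Zk.
- rewrite (@eq_Rintegral _ _ _ _ _ (fun x => cosk (k - l) x - cosk (k + l) x)); last first.
    move=> x _; rewrite /cosk /sink subE dotZD mulrBr (mulrDr (2 * pi)) cosB cosD mulrACA ss; ring.
  by rewrite RintegralB// !Cd neq0 ?Zk ?Zl// subr0 subr_eq0.
Qed.

End orthonormality.

Lemma bounded_Lfun d (T : measurableType d) (R : realType)
    (P : probability T R) (f : T -> R) (M r : R) : 0 <= r ->
  measurable_fun setT f -> (forall x, `|f x| <= M) -> f \in Lfun P r%:E.
Proof.
move=> r0 mf fM; rewrite inE/=; apply/andP; split; rewrite inE//=.
rewrite /finite_norm unlock poweR_lty//=.
apply: integrable_lty => //.
apply: (@bounded_integrable _ _ _ P (fun x => `|f x| `^ r) (M `^ r)).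
  by apply: (measurableT_comp (measurable_powR r)); exact: measurableT_comp.
by move=> x; rewrite ger0_norm ?powR_ge0// ge0_ler_powR// ?nnegrE// (le_trans _ (fM x)).
Qed.

(** Turns the sums over all frequencies in the definition of the class into finite sums over the
    frequencies actually used. *)
Lemma esum_finite_support (R : realType) (I : choiceType) (E : finType)
    (kap : E -> I) (D : pred I) (a : I -> R) : injective kap ->
  (forall i, 0 <= a i) -> (forall i, (forall e, kap e != i) -> a i = 0) ->
  (\esum_(i in [set i | D i]) (a i)%:E = (\sum_(e | D (kap e)) a (kap e))%:E)%E.
Proof.
move=> kap_inj a0 asupp.
rewrite (@esumID _ _ [set i | exists e, kap e = i])//; last first.
  by move=> i _; rewrite lee_fin.
rewrite [X in (_ + X)%E]esum1 ?adde0; last first.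
  move=> i /= [_ ni]; rewrite asupp// => e; apply/eqP => ei; apply: ni; by exists e.
have -> : [set i | D i] `&` [set i | exists e, kap e = i] =
    kap @` [set e | D (kap e)].
  apply/seteqP; split=> i /=; first by move=> [Di [e ei]]; exists e; rewrite // ei.
  by move=> [e De <-]; split=> //; exists e.
rewrite esum_image; last by move=> x y _ _; exact: kap_inj.
rewrite esum_fset; [|exact: finite_finset|by move=> e _; rewrite lee_fin].
rewrite -sumEFin -[RHS]big_filter [RHS]fsbig_seq ?filter_uniq ?index_enum_uniq//.
suff -> : [set` [seq e <- index_enum E | D (kap e)]] = [set e | D (kap e)] by [].
by apply/seteqP; split=> e /=; rewrite mem_filter mem_index_enum andbT.
Qed.

(** * Finite trigonometric sums as members of the class *)

Section signal.
Variables (R : realType) (d : nat) (E : finType).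
Variables (kap : E -> {ffun 'I_d -> int}) (c : E -> R).
Hypothesis kap_inj : injective kap.

Definition signal (x : d.-tuple R) : R := \sum_e c e * fourier_basis (kap e) x.

Lemma measurable_signal : measurable_fun setT signal.
Proof.
apply: measurable_sum => e; apply: measurable_funM => //.
exact: measurable_fourier_basis.
Qed.

Lemma normr_signal_le x : `|signal x| <= \sum_e `|c e| * 2.
Proof.
apply: (le_trans (ler_norm_sum _ _ _)); apply: ler_sum => e _.
by rewrite normrM ler_wpM2l// normr_fourier_basis_le.
Qed.

Lemma theta_signal k : theta k signal = \sum_e c e * (kap e == k)%:R.
Proof.
rewrite /theta /signal.
under eq_Rintegral do rewrite mulr_suml.
have mt e : measurable_fun setT
    (fun x : d.-tuple R => c e * fourier_basis (kap e) x * fourier_basis k x).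
  apply: measurable_funM; last exact: measurable_fourier_basis.
  by apply: measurable_funM => //; exact: measurable_fourier_basis.
have bt e x : `|c e * fourier_basis (kap e) x * fourier_basis k x| <= `|c e| * 2 * 2.
  rewrite !normrM ler_pM// ?mulr_ge0//.
    by rewrite ler_wpM2l// normr_fourier_basis_le.
  exact: normr_fourier_basis_le.
have it (s : seq E) : (cube_measure R d).-integrable setT (EFin \o
    (fun x => \sum_(e <- s) c e * fourier_basis (kap e) x * fourier_basis k x)).
  apply: (@bounded_integrable _ _ _ _ _ (\sum_(e <- s) `|c e| * 2 * 2)).
    by apply: measurable_sum => e; exact: mt.
  by move=> x; apply: (le_trans (ler_norm_sum _ _ _)); apply: ler_sum.
have step (s : seq E) : \int[cube_measure R d]_x
      (\sum_(e <- s) c e * fourier_basis (kap e) x * fourier_basis k x) =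
    \sum_(e <- s) c e * (kap e == k)%:R.
  elim: s => [|e s IH].
    under eq_Rintegral do rewrite big_nil.
    by rewrite big_nil Rintegral_cst// mul0r.
  under eq_Rintegral do rewrite big_cons.
  have ie := bounded_integrable (cube_measure R d) (mt e) (bt e).
  rewrite (RintegralD measurableT ie (it s)) IH big_cons; congr (_ + _).
  under eq_Rintegral do rewrite -mulrA.
  rewrite RintegralZl ?fourier_basis_orthonormal//.
  apply: (@bounded_integrable _ _ _ _ _ (2 * 2)).
    by apply: measurable_funM; exact: measurable_fourier_basis.
  by move=> x; rewrite normrM ler_pM// normr_fourier_basis_le.
exact: step.
Qed.

Lemma theta_signal_kap e : theta (kap e) signal = c e.
Proof.
rewrite theta_signal (bigD1 e)//= eqxx mulr1 big1 ?addr0// => e' ne.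
by rewrite (inj_eq kap_inj) (negbTE ne) mulr0.
Qed.

Lemma theta_signal0 k : (forall e, kap e != k) -> theta k signal = 0.
Proof. by move=> h; rewrite theta_signal big1// => e _; rewrite (negbTE (h e)) mulr0. Qed.

Variables (J : {set 'I_d}) (dstar : nat) (kappa L : R).
Hypothesis cardJ : #|J| = dstar.
Hypothesis kapJ : forall e j, j \notin J -> kap e j = 0.
Hypothesis kappa0 : 0 < kappa.
Hypothesis c_lower : forall j, j \in J -> kappa <= \sum_(e | kap e j != 0) c e ^+ 2.
Hypothesis c_upper : forall j, \sum_e (kap e j)%:~R ^+ 2 * c e ^+ 2 <= L.

Lemma signal_factors : exists fbar : #|J|.-tuple R -> R,
  forall x, in_cube x -> signal x = fbar (subvector J x).
Proof.
(* Extension by 0 outside [J]; the frequencies vanish there, so every phase is unchanged. *)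
pose ext (y : #|J|.-tuple R) : d.-tuple R :=
  [tuple (if insub j is Some u
          then tnth y (enum_rank_in (valP (u : {j | j \in J})) j) else 0) | j < d].
exists (fun y => signal (ext y)) => x _.
apply: eq_bigr => e _; congr (_ * _).
have dE : dotZ (kap e) x = dotZ (kap e) (ext (subvector J x)).
  apply: eq_bigr => j _.
  have [jJ|jJ] := boolP (j \in J); last by rewrite kapJ// !mul0r.
  congr (_ * _); rewrite tnth_mktuple insubT /= tnth_mktuple.
  by rewrite enum_rankK_in.
by rewrite /fourier_basis dE.
Qed.

Let theta_sqr0 k : (forall e, kap e != k) -> theta k signal ^+ 2 = 0.
Proof. by move=> /theta_signal0 ->; rewrite expr0n. Qed.

Lemma signal_sparsity_pattern : is_sparsity_pattern dstar kappa signal J.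
Proof.
split=> //; first exact: signal_factors.
move=> j jJ.
rewrite (@esum_finite_support _ _ _ kap (fun k => k j != 0)
  (fun k => theta k signal ^+ 2))//.
- rewrite lee_fin (le_trans (c_lower jJ))//.
  by apply: ler_sum => e _; rewrite theta_signal_kap.
- by move=> k; rewrite sqr_ge0.
Qed.

(** The pattern chosen by [xget] has the cardinality of [J], so inclusion in [J] suffices for
    equality. A coordinate outside [J] carries zero energy, which is less than [kappa]. *)
Lemma sparsity_pattern_signal : sparsity_pattern dstar kappa signal = J.
Proof.
rewrite /sparsity_pattern; case: xgetP => [J' _ [cardJ' _ low]|/(_ J)[]]; last first.
  exact: signal_sparsity_pattern.
apply/eqP; rewrite eqEcard cardJ cardJ' leqnn andbT.
apply/fintype.subsetP => j /low; apply: contraTT => jJ.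
rewrite -ltNge (@esum_finite_support _ _ _ kap (fun k => k j != 0)
  (fun k => theta k signal ^+ 2))//.
  by rewrite big1 ?lte_fin// => e; rewrite kapJ// eqxx.
by move=> k; rewrite sqr_ge0.
Qed.

Lemma signal_Sigma : Sigma_class dstar kappa L signal.
Proof.
split; last by exists J; exact: signal_sparsity_pattern.
  by apply: bounded_Lfun measurable_signal normr_signal_le => //; lra.
move=> j.
have := @esum_finite_support R _ _ kap xpredT
  (fun k => (k j)%:~R ^+ 2 * theta k signal ^+ 2) kap_inj.
rewrite /= (_ : [set _ | true] = setT); last by apply/seteqP; split.
move=> ->.
- rewrite lee_fin (le_trans _ (c_upper j))//.
  by apply: ler_sum => e _; rewrite theta_signal_kap.
- by move=> k; rewrite mulr_ge0 ?sqr_ge0.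
- by move=> k /theta_sqr0 ->; rewrite mulr0.
Qed.

End signal.

(** * Minimax lower bound for mixtures of signals *)

Section likelihood_ratio.
Local Open Scope ereal_scope.
Variables (R : realType) (d : nat).
Local Notation I := {ffun 'I_d -> int}.
Local Notation T := (g_sigma_algebraType (@coordinate_sets R d)).
Context (dO : measure_display) (Omega : measurableType dO) (P : probability Omega R).
Variable (xi : I -> {RV P >-> R}).
Hypothesis xi_iid : iid_standard_normal xi.
Variables (E : finType) (kap : E -> I).
Hypothesis kap_inj : injective kap.

(** The density, with respect to the law of the pure noise, of the noise shifted by [t e] at each
    frequency [kap e]. *)
Definition likelihood_ratio (t : E -> R) (w : Omega) : R :=
  expR (\sum_e (t e * xi (kap e) w - t e ^+ 2 / 2)).

Lemma measurable_likelihood_ratio t : measurable_fun setT (likelihood_ratio t).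
Proof.
apply: measurableT_comp => //; apply: measurable_sum => e.
by apply: measurable_funB => //; exact: measurable_funM.
Qed.

Lemma integral_shift (t : E -> R) (f : T -> \bar R) :
  measurable_fun setT f -> (forall y, 0 <= f y) ->
  \int[P]_w f (fun j => (xi j w + \sum_e t e * (kap e == j)%:R)%R) =
  \int[P]_w (f (noise xi w) * (likelihood_ratio t w)%:E).
Proof.
move=> mf f0; pose c j := (\sum_e t e * (kap e == j)%:R)%R.
have cE e : c (kap e) = t e.
  rewrite /c (bigD1 e)//= eqxx mulr1 big1 ?addr0// => e' ne.
  by rewrite (inj_eq kap_inj) (negbTE ne) mulr0.
pose s := [seq kap e | e <- index_enum E].
have us : uniq s by rewrite map_inj_uniq// index_enum_uniq.
have := noise_shift xi_iid c us mf f0.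
rewrite (eq_integral (fun w => f (fun j => (xi j w + c j)%R))); last first.
  move=> w _; congr f; apply/funext => j; congr +%R.
  case: ifPn => // js; rewrite /c big1// => e _.
  case: eqP => [ej|]; last by rewrite mulr0.
  by move: js; rewrite -ej map_f// mem_index_enum.
move=> ->; apply: eq_integral => w _; congr (_ * (expR _)%:E).
by rewrite big_map; apply: eq_bigr => e _; rewrite cE.
Qed.

Lemma integral_likelihood_ratio t : \int[P]_w (likelihood_ratio t w)%:E = 1.
Proof.
have := @integral_shift t (cst 1) (measurable_cst _) (fun=> lee01).
under [X in _ = X]eq_integral do rewrite mul1e.
by move=> <-; rewrite integral_cst// mul1e; exact: probability_setT.
Qed.

(** The squares in the exponents recombine up to the cross term. As a likelihood ratio has mean 1,
    the mean of the product is the exponential of the inner product of the two shifts. *)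
Lemma likelihood_ratioM t t' w :
  (likelihood_ratio t w * likelihood_ratio t' w =
   expR (\sum_e t e * t' e) * likelihood_ratio (fun e => t e + t' e) w)%R.
Proof.
rewrite -!expRD -!big_split /=; congr expR; apply: eq_bigr => e _; lra.
Qed.

Lemma integral_likelihood_ratioM t t' :
  \int[P]_w (likelihood_ratio t w * likelihood_ratio t' w)%:E =
  (expR (\sum_e t e * t' e)%R)%:E.
Proof.
under eq_integral do rewrite likelihood_ratioM EFinM.
rewrite ge0_integralZl_EFin ?integral_likelihood_ratio ?mule1 ?expR_ge0//.
- by move=> w _; rewrite lee_fin expR_ge0.
- by apply/measurable_EFinP; exact: measurable_likelihood_ratio.
Qed.

End likelihood_ratio.

(** * Uniform mixtures over coefficient vectors indexed by [W] *)

Section minimax.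
Variables (R : realType) (d dstar n : nat) (kappa L alpha : R).
Local Notation I := {ffun 'I_d -> int}.
Local Notation T := (g_sigma_algebraType (@coordinate_sets R d)).
Context (dO : measure_display) (Omega : measurableType dO) (P : probability Omega R).
Variable (xi : I -> {RV P >-> R}).
Hypothesis xi_iid : iid_standard_normal xi.
Variables (E W : finType) (kap : {set 'I_d} -> E -> I) (c : W -> E -> R).
Hypothesis n_gt0 : (0 < n)%N.
Hypothesis kappa_gt0 : 0 < kappa.
Hypothesis alpha_ge0 : 0 <= alpha.
Hypothesis models_ge3 : (3 <= 'C(d, dstar))%N.
Hypothesis W_gt0 : (0 < #|W|)%N.
Hypothesis kap_inj : forall J : {set 'I_d}, #|J| = dstar -> injective (kap J).
Hypothesis kapJ : forall (J : {set 'I_d}) e j, #|J| = dstar -> j \notin J -> kap J e j = 0.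
Hypothesis c_lower : forall (J : {set 'I_d}) w j, #|J| = dstar -> j \in J ->
  kappa <= \sum_(e | kap J e j != 0) c w e ^+ 2.
Hypothesis c_upper : forall (J : {set 'I_d}) w j, #|J| = dstar ->
  \sum_e (kap J e j)%:~R ^+ 2 * c w e ^+ 2 <= L.
(** The coefficients are shared by all patterns, only the frequencies change with [J]; hence a
    single second-moment bound serves every pattern. *)
Hypothesis second_moment :
  \sum_w \sum_w' expR (n%:R * \sum_e c w e * c w' e) <=
  #|W|%:R ^+ 2 * expR (alpha * ln ('C(d, dstar))%:R).

Let rn : R := Num.sqrt n%:R.

Let rn_gt0 : 0 < rn. Proof. by rewrite sqrtr_gt0 ltr0n. Qed.

Let rn2 : rn ^+ 2 = n%:R. Proof. by rewrite sqr_sqrtr. Qed.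

Let ratio J w := likelihood_ratio xi (kap J) (fun e => rn * c w e).

Let mixture J x : R := #|W|%:R^-1 * \sum_w ratio J w x.

Let W_gt0R : 0 < #|W|%:R :> R. Proof. by rewrite ltr0n. Qed.

Let m_ratio J w : measurable_fun setT (ratio J w).
Proof. exact: measurable_likelihood_ratio. Qed.

Let m_mixture J : measurable_fun setT (mixture J).
Proof. by apply: measurable_funM => //; apply: measurable_sum => w. Qed.

Let mixture_gt0 J x : 0 < mixture J x.
Proof.
rewrite mulr_gt0 ?invr_gt0//.
have /card_gt0P[w _] := W_gt0; rewrite (bigD1 w)//= ltr_pwDl ?expR_gt0//.
by apply: sumr_ge0 => w' _; exact: expR_ge0.
Qed.

Let integral_mixture J (A : set Omega) : measurable A ->
  (\int[P]_(x in A) (mixture J x)%:E =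
   (#|W|%:R^-1)%:E * \sum_w \int[P]_(x in A) (ratio J w x)%:E)%E.
Proof.
move=> mA; under eq_integral do rewrite EFinM -sumEFin.
rewrite ge0_integralZl_EFin ?invr_ge0//.
- rewrite ge0_integral_sum//.
    by move=> w; apply/measurable_EFinP; exact: measurable_funTS.
  by move=> w x _; rewrite lee_fin expR_ge0.
- by move=> x _; apply: sume_ge0 => w _; rewrite lee_fin expR_ge0.
- apply: emeasurable_sum => w; apply/measurable_EFinP; exact: measurable_funTS.
Qed.

Let integral_mixture1 (J : {set 'I_d}) : #|J| = dstar -> (\int[P]_x (mixture J x)%:E = 1)%E.
Proof.
move=> cJ; have r1 w : (\int[P]_x (ratio J w x)%:E = 1)%E.
  by apply: integral_likelihood_ratio => //; exact: kap_inj.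
rewrite integral_mixture//; under eq_bigr do rewrite r1.
by rewrite sumEFin sumr_const -EFinM mulVf// gt_eqF.
Qed.

Let integral_mixture2 (J : {set 'I_d}) : #|J| = dstar ->
  (\int[P]_x (mixture J x ^+ 2)%:E <= (expR (alpha * ln ('C(d, dstar))%:R))%:E)%E.
Proof.
move=> cJ.
have E2 x : mixture J x ^+ 2 =
    #|W|%:R^-2 * \sum_w \sum_w' ratio J w x * ratio J w' x.
  rewrite exprMn exprVn; congr (_ * _); rewrite expr2 mulr_suml.
  by apply: eq_bigr => w _; rewrite mulr_sumr.
under eq_integral do rewrite E2 EFinM -sumEFin.
have r0 w w' x : 0 <= ratio J w x * ratio J w' x by rewrite mulr_ge0// expR_ge0.
have mr w w' : measurable_fun setT (fun x => ratio J w x * ratio J w' x).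
  exact: measurable_funM.
rewrite ge0_integralZl_EFin; [|by []
  |by move=> x _; apply: sume_ge0 => w _; rewrite lee_fin sumr_ge0
  |by apply: emeasurable_sum => w; apply/measurable_EFinP; exact: measurable_sum
  |by rewrite invr_ge0 sqr_ge0].
rewrite ge0_integral_sum; [|by []
  |by move=> w; apply/measurable_EFinP; exact: measurable_sum
  |by move=> w x _; rewrite lee_fin sumr_ge0].
have -> : (\sum_w \int[P]_x (\sum_w' ratio J w x * ratio J w' x)%:E =
    (\sum_w \sum_w' expR (n%:R * \sum_e c w e * c w' e))%:E)%E.
  rewrite -sumEFin; apply: eq_bigr => w _.
  under eq_integral do rewrite -sumEFin.
  rewrite ge0_integral_sum; [|by []|by move=> w'; apply/measurable_EFinP
    |by move=> w' x _; rewrite lee_fin].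
  rewrite -sumEFin; apply: eq_bigr => w' _.
  rewrite integral_likelihood_ratioM//; last exact: kap_inj.
  congr (expR _)%:E; rewrite mulr_sumr; apply: eq_bigr => e _.
  by rewrite mulrACA -expr2 rn2.
by rewrite -EFinM lee_fin mulrC ler_pdivrMr ?exprn_gt0// mulrC.
Qed.

(** Fano's bound yields a pattern [J] that is output with mixture probability at most
    [1 / 2 + alpha]. This is an average over [w], so some [w] does no worse, and its signal is in
    the class with pattern [J]. *)
Lemma minimax_lower_bound : ((1 / 2 - alpha)%:E <= minimax_error dstar n kappa L xi)%E.
Proof.
apply: le_ereal_inf_tmp => _ [Jt estJt <-].
(* The estimator as a function of the data multiplied by [rn], for which the noise has unit variance
   and the coefficients become [rn * c w e]. *)
pose Jn (y : T) : {set 'I_d} := Jt (fun k => rn^-1 * y k).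
have mscale : measurable_fun setT (fun y : T => (fun k => rn^-1 * y k) : T).
  apply: measurable_to_sequence => k; apply: measurable_funM => //.
  exact: measurable_coordinate.
have mJn A : measurable (Jn @^-1` A).
  rewrite -[X in measurable X]setTI; apply: (mscale measurableT (Jt @^-1` A)).
  exact: estJt.
have mphi J : measurable ((Jn \o noise xi) @^-1` [set J]).
  rewrite -[X in measurable X]setTI.
  exact: (@measurable_noise _ _ _ _ _ xi measurableT _ (mJn [set J])).
pose S := [set J : {set 'I_d} | #|J| == dstar]%SET.
have cS : #|S| = 'C(d, dstar) by rewrite card_draws card_ord.
have [J] := @fano_second_moment _ _ _ P _ S alpha mixture (Jn \o noise xi)
  alpha_ge0 ltac:(by rewrite cS) mphi m_mixture mixture_gt0
  ltac:(by move=> J; rewrite inE => /eqP; exact: integral_mixture1)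
  ltac:(by move=> J; rewrite inE cS => /eqP; exact: integral_mixture2).
rewrite inE => /eqP cJ; rewrite (integral_mixture _ (mphi J)) => avg.
pose X w (x : Omega) : T := fun j => xi j x + \sum_e rn * c w e * (kap J e == j)%:R.
have mX w : measurable_fun setT (X w).
  by apply: measurable_to_sequence => k; exact: measurable_funD.
pose B := Jn @^-1` [set J].
have obsE w x : Jt (observation n xi (signal (kap J) (c w)) x) = Jn (X w x).
  congr Jt; apply/funext => k; rewrite /observation theta_signal /X.
  rewrite mulrDr addrC; congr (_ + _).
  under [in RHS]eq_bigr do rewrite -mulrA.
  by rewrite -mulr_sumr mulrA mulVf ?mul1r// gt_eqF.
have mXB w : measurable (X w @^-1` B).
  by rewrite -[Y in measurable Y]setTI; apply: mX => //; exact: mJn.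
(* Change of measure: weighting the event for pure noise by the likelihood ratio gives its
   probability under the rescaled observation [X w]. *)
have pE w : (\int[P]_(x in (Jn \o noise xi) @^-1` [set J]) (ratio J w x)%:E =
    P (X w @^-1` B))%E.
  have mB : measurable_fun setT (fun y : T => (\1_B y)%:E : \bar R).
    by apply/measurable_EFinP; apply: measurable_indic; exact: mJn.
  have B0 (y : T) : (0 <= (\1_B y)%:E :> \bar R)%E by rewrite lee_fin.
  have sh := integral_shift xi_iid (kap_inj cJ) (fun e => rn * c w e) mB B0.
  transitivity (\int[P]_x ((\1_B (noise xi x))%:E * (ratio J w x)%:E))%E.
    rewrite integral_mkcond; apply: eq_integral => x _.
    rewrite patchE indicE /B.
    have -> : (x \in (Jn \o noise xi) @^-1` [set J]) = (noise xi x \in Jn @^-1` [set J]).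
      by apply/idP/idP; rewrite !inE.
    by case: (_ \in _); rewrite /= ?mul1e ?mul0e.
  rewrite -sh -(setIT (X w @^-1` B)) -integral_indic//.
pose p w := fine (P (X w @^-1` B)).
have pF w : P (X w @^-1` B) = (p w)%:E by rewrite fineK// fin_num_measure.
have [w pw] : exists w, p w <= 1 / 2 + alpha.
  apply: contrapT => hn.
  have big w : 1 / 2 + alpha < p w by rewrite ltNge; apply/negP => h; apply: hn; exists w.
  move: avg; under eq_bigr do rewrite pE pF.
  rewrite sumEFin -EFinM lee_fin mulrC ler_pdivrMr// leNgt => /negP; apply.
  rewrite mulr_natr -sumr_const; apply: ltr_sum => //.
  by have /card_gt0P[w _] := W_gt0; apply/hasP; exists w; rewrite ?mem_index_enum.
apply: le_ereal_sup_tmp; exists (error_prob dstar n kappa xi Jt (signal (kap J) (c w))).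
  exists (signal (kap J) (c w)) => //.
  apply: (@signal_Sigma _ _ _ _ _ (kap_inj cJ) J) => // [e j|j|j].
  - exact: kapJ.
  - exact: c_lower.
  - exact: c_upper.
rewrite /error_prob (@sparsity_pattern_signal _ _ _ _ _ (kap_inj cJ) J)//; last 2 first.
- by move=> e j; exact: kapJ.
- by move=> j; exact: c_lower.
have -> : [set x | Jt (observation n xi (signal (kap J) (c w)) x) != J] = ~` (X w @^-1` B).
  apply/seteqP; split=> x /=; rewrite obsE; first by move=> /eqP.
  by move=> h; apply/eqP.
rewrite probability_setC// pF -EFinB lee_fin; lra.
Qed.

End minimax.

(** * Large deviations and the Jacobi theta function *)

Section exponential_bounds.
Variable R : realType.

(** Since [expR (- x) >= 1 - x], [expR x] is at most [1 / (1 - x)], and [(1 + x + 2 x^2) (1 - x) = 1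
    + x^2 (1 - 2 x) >= 1]. Arbitrarily negative [x] are included. *)
Lemma expR_le_quadratic (x : R) : x <= 1 / 2 -> expR x <= 1 + x + 2 * x ^+ 2.
Proof.
move=> x12; have h := expR_ge1Dx (- x).
have e0 := expR_gt0 x.
have e1 : expR x * expR (- x) = 1 by rewrite expRxMexpNx_1.
have : expR x * (1 - x) <= 1 by rewrite -[leRHS]e1 ler_pM2l.
have : expR x <= (1 - x)^-1 -> expR x <= 1 + x + 2 * x ^+ 2.
  move=> /le_trans; apply; rewrite -[leLHS]mul1r ler_pdivrMr; last lra.
  have : 0 <= x ^+ 2 * (1 - 2 * x) by rewrite mulr_ge0 ?sqr_ge0//; lra.
  lra.
move=> + h'; apply; rewrite -[leRHS]mul1r ler_pdivlMr; [exact: h'|lra].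
Qed.

(** The quadratic bound handles small [x]; beyond 1/2, [x <= 2 x^2] suffices. The lossy constant 2
    is the one in front of [#|F|] in [exists_rich_set]. *)
Lemma cosh_le (x : R) : (expR x + expR (- x)) / 2 <= expR (2 * x ^+ 2).
Proof.
wlog x0 : x / 0 <= x.
  move=> H; have [/H//|x0] := leP 0 x.
  have := H (- x); rewrite opprK sqrrN addrC; apply; lra.
have [x12|x12] := leP x (1 / 2).
  apply: (@le_trans _ _ (1 + 2 * x ^+ 2)); last exact: expR_ge1Dx.
  have h1 := expR_le_quadratic x12.
  have h2 : expR (- x) <= 1 + - x + 2 * (- x) ^+ 2 by apply: expR_le_quadratic; lra.
  rewrite sqrrN in h2; lra.
have h1 : expR (- x) <= expR x by rewrite ler_expR; lra.
have h2 : expR x <= expR (2 * x ^+ 2) by rewrite ler_expR; nra.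
lra.
Qed.

Lemma sum_prod_ffun (I : finType) d (f : I -> R) :
  \sum_(k : {ffun 'I_d -> I}) \prod_j f (k j) = (\sum_i f i) ^+ d.
Proof.
by rewrite -(bigA_distr_bigA (fun=> f)) /= prodr_const card_ord.
Qed.

(** The rate [rho] is the moment generating function of [u] at a small [s > 0], below 1 because the
    mean of [u] is negative. It does not depend on the number [d] of independent draws. *)
Lemma chernoff (I : finType) (q u : I -> R) :
  (forall i, 0 <= q i) -> \sum_i q i = 1 -> \sum_i q i * u i < 0 ->
  exists rho, [/\ 0 <= rho, rho < 1 & forall d,
    \sum_(k : {ffun 'I_d -> I} | 0 <= \sum_j u (k j)) \prod_j q (k j) <= rho ^+ d].
Proof.
move=> q0 q1 m0; set m := \sum_i _ in m0.
pose V := \sum_i q i * u i ^+ 2; pose M := 1 + \sum_i `|u i|.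
have V0 : 0 <= V by apply: sumr_ge0 => i _; rewrite mulr_ge0// sqr_ge0.
have M1 : 1 <= M by rewrite lerDl sumr_ge0.
have uM i : u i <= M.
  rewrite (le_trans (ler_norm _))// /M (bigD1 i)//=.
  have : 0 <= \sum_(j | j != i) `|u j| by rewrite sumr_ge0.
  lra.
(* The first bound keeps [s * u i] below 1/2, as [expR_le_quadratic] requires; the second makes the
   quadratic term [2 * s ^+ 2 * V] smaller than half of the linear gain [- s * m]. *)
pose s := Num.min ((2 * M)^-1) (- m / (4 * (V + 1))).
have s0 : 0 < s.
  by rewrite lt_min invr_gt0 divr_gt0 ?andbT; lra.
have s1 : s * M <= 1 / 2.
  have : s <= (2 * M)^-1 by rewrite ge_min lexx.
  by rewrite -[leRHS]mul1r ler_pdivlMr; lra.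
have s2 : s * (4 * (V + 1)) <= - m.
  have : s <= - m / (4 * (V + 1)) by rewrite ge_min lexx orbT.
  by rewrite ler_pdivlMr; lra.
pose rho := \sum_i q i * expR (s * u i).
exists rho; split.
- by apply: sumr_ge0 => i _; rewrite mulr_ge0// expR_ge0.
- apply: (@le_lt_trans _ _ (1 + s * m + 2 * s ^+ 2 * V)); last by nra.
  have -> : 1 + s * m + 2 * s ^+ 2 * V = \sum_i q i + s * m + 2 * s ^+ 2 * V by rewrite q1.
  rewrite /m /V !mulr_sumr -!big_split /=; apply: ler_sum => i _.
  have h : s * u i <= 1 / 2 by have := uM i; nra.
  have := ler_wpM2l (q0 i) (expR_le_quadratic h).
  rewrite exprMn => /le_trans; apply; lra.
move=> d; rewrite /rho -sum_prod_ffun.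
rewrite [leRHS](bigID (fun k : {ffun 'I_d -> I} => 0 <= \sum_j u (k j))) /=.
rewrite -[leLHS]addr0; apply: lerD; last first.
  by apply: sumr_ge0 => k _; apply: prodr_ge0 => j _; rewrite mulr_ge0// expR_ge0.
apply: ler_sum => k ku; rewrite big_split /= ler_peMr//.
  by apply: prodr_ge0.
by rewrite -expR_sum -mulr_sumr -expR0 ler_expR mulr_ge0// ltW.
Qed.

End exponential_bounds.

(** * Power series with polynomially bounded coefficients *)

Section power_series.
Variable R : realType.

Lemma natS_expr_le (t : R) (n : nat) : 0 < t < 1 -> n.+1%:R * t ^+ n <= (1 - t)^-1.
Proof.
move=> /andP[t0 t1]; have u0 : 0 < 1 - t by lra.
rewrite -[leRHS]mul1r ler_pdivlMr//.
have geo m : (1 - t) * \sum_(i < m) t ^+ i = 1 - t ^+ m.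
  by have := subrX1 t m; lra.
have le1 : n.+1%:R * t ^+ n <= \sum_(i < n.+1) t ^+ i.
  rewrite mulr_natl -[X in _ *+ X](card_ord n.+1) -sumr_const; apply: ler_sum => i _.
  by rewrite ler_wiXn2l ?ltW// -ltnS.
have := geo n.+1; have : 0 < t ^+ n.+1 by rewrite exprn_gt0.
nra.
Qed.

(** At [t ^+ 5], four factors [t ^+ n] absorb the polynomial of degree 4 by [natS_expr_le] and the
    fifth leaves a geometric series. Degree 4 covers the coefficients obtained by differentiating
    twice a series with coefficients of quadratic growth. *)
Lemma cvg_pseries_poly_bound (f : nat -> R) (C t : R) : 0 < t < 1 ->
  (forall n, `|f n| <= C * n.+1%:R ^+ 4) -> cvgn (pseries f (t ^+ 5)).
Proof.
move=> t01 fC; have /andP[t0 t1] := t01.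
apply: normed_cvg.
have C0 : 0 <= C by have := le_trans (normr_ge0 _) (fC 0%N); rewrite expr1n mulr1.
pose D := C * (1 - t)^-1 ^+ 4.
have D0 : 0 <= D by rewrite mulr_ge0// exprn_ge0// invr_ge0; lra.
apply: (@series_le_cvg _ _ (geometric D t)).
- by move=> n; exact: normr_ge0.
- by move=> n /=; rewrite mulr_ge0// exprn_ge0// ltW.
- move=> n /=; rewrite normrM normrX (ger0_norm (exprn_ge0 5 (ltW t0))).
  apply: (@le_trans _ _ (C * n.+1%:R ^+ 4 * (t ^+ 5) ^+ n)).
    by rewrite ler_wpM2r// !exprn_ge0// ltW.
  have -> : C * n.+1%:R ^+ 4 * (t ^+ 5) ^+ n = C * (n.+1%:R * t ^+ n) ^+ 4 * t ^+ n.
    by rewrite exprAC exprSr [in RHS]exprMn !mulrA.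
  apply: ler_wpM2r; first by rewrite exprn_ge0 ?ltW.
  apply: ler_wpM2l => //; apply: lerXn2r; rewrite ?nnegrE ?invr_ge0.
  - by rewrite mulr_ge0 ?exprn_ge0 ?ltW.
  - lra.
  - exact: natS_expr_le.
- by apply: is_cvg_geometric_series; rewrite ger0_norm// ltW.
Qed.

Lemma exists_fifth_power (x : R) : `|x| < 1 ->
  exists2 t, 0 < t < 1 & `|x| < `|t ^+ 5|.
Proof.
(* With this [u], [(1 - u) ^+ 5 >= 1 - 5 * u], which exceeds [1 - 6 * u], that is, [|x|]. *)
move=> x1; pose u := (1 - `|x|) / 6; have x0 := normr_ge0 x.
exists (1 - u); first by rewrite /u; lra.
have u0 : 0 < u by rewrite /u; lra.
have u1 : u <= 1 / 6 by rewrite /u; lra.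
have xE : `|x| = 1 - 6 * u by rewrite /u; lra.
have h5 : 0 <= (1 - u) ^+ 5 by apply: exprn_ge0; lra.
have h2 : 1 - 2 * u <= (1 - u) ^+ 2 by have := sqr_ge0 u; lra.
have h4 : 1 - 4 * u <= (1 - u) ^+ 4 by rewrite (_ : 4 = 2 * 2)%N// exprM; nra.
rewrite (ger0_norm h5) xE exprSr; nra.
Qed.

Lemma pseries_diffs_bound (f : nat -> R) (C : R) (j : nat) :
  (forall n, `|f n| <= C * n.+1%:R ^+ j) ->
  forall n, `|pseries_diffs f n| <= C * 2 ^+ j * n.+1%:R ^+ j.+1.
Proof.
move=> fC n; rewrite /pseries_diffs normrM ger0_norm//.
apply: (@le_trans _ _ (n.+1%:R * (C * n.+2%:R ^+ j))).
  by rewrite ler_wpM2l.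
have C0 : 0 <= C by have := le_trans (normr_ge0 _) (fC 0%N); rewrite expr1n mulr1.
rewrite exprS [leRHS]mulrCA ler_wpM2l// -mulrA ler_wpM2l// -exprMn lerXn2r// ?nnegrE//.
by rewrite -natrM ler_nat; lia.
Qed.

Lemma pow_bound_weaken (f : nat -> R) (C : R) (i j : nat) : (i <= j)%N ->
  (forall n, `|f n| <= C * n.+1%:R ^+ i) -> forall n, `|f n| <= C * n.+1%:R ^+ j.
Proof.
move=> ij fC n; apply: (le_trans (fC n)); rewrite ler_wpM2l//.
  by have := le_trans (normr_ge0 _) (fC 0%N); rewrite expr1n mulr1.
by rewrite ler_weXn2l// ler1n.
Qed.

Lemma is_cvg_pseries_poly (f : nat -> R) (C x : R) : `|x| < 1 ->
  (forall n, `|f n| <= C * n.+1%:R ^+ 4) -> cvgn (pseries f x).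
Proof.
move=> /exists_fifth_power[t t01 xt] fC.
exact: is_cvg_pseries_inside (cvg_pseries_poly_bound t01 fC) xt.
Qed.

Lemma is_derive_pseries (f : nat -> R) (C x : R) : `|x| < 1 ->
  (forall n, `|f n| <= C * n.+1%:R ^+ 2) ->
  is_derive x (1 : R) (fun x => limn (pseries f x)) (limn (pseries (pseries_diffs f) x)).
Proof.
move=> /exists_fifth_power[t t01 xt] f1.
have f2 := pseries_diffs_bound f1; have f3 := pseries_diffs_bound f2.
apply: (@pseries_snd_diffs _ _ (t ^+ 5)) => //.
- exact: (cvg_pseries_poly_bound t01 (pow_bound_weaken (_ : 2 <= 4)%N f1)).
- exact: (cvg_pseries_poly_bound t01 (pow_bound_weaken (_ : 3 <= 4)%N f2)).
- exact: (cvg_pseries_poly_bound t01 f3).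
Qed.

End power_series.

(** * The Jacobi theta function as a power series *)

Section jacobi.
Variable R : realType.

(* Number of integers r with `|r| = m. *)
Definition sign_count (m : nat) : R := if m == 0%N then 1 else 2.

(* Coefficients of the power series sum_r z ^ (r ^ 2). *)
Definition theta_coef (n : nat) : R :=
  \sum_(m < n.+1) (m ^ 2 == n)%N%:R * sign_count m.

Lemma sign_count_ge0 m : 0 <= sign_count m.
Proof. by rewrite /sign_count; case: ifP. Qed.

Lemma sign_count_le2 m : sign_count m <= 2.
Proof. by rewrite /sign_count; case: ifP; lra. Qed.

Lemma theta_coef_widen n K : (n < K)%N ->
  theta_coef n = \sum_(m < K) (m ^ 2 == n)%N%:R * sign_count m.
Proof.
move=> nK; rewrite /theta_coef (big_ord_widen K (fun m => (m ^ 2 == n)%N%:R * sign_count m))//.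
rewrite big_mkcond; apply: eq_bigr => m _; case: ifPn => //; rewrite -leqNgt => nm.
rewrite (_ : _ == _ = false) ?mul0r//; apply/negbTE; rewrite neq_ltn; apply/orP; right.
nia.
Qed.

(** The coefficients vanish away from squares, so cutting the power series just after [N ^ 2] gives
    exactly the integers of absolute value at most [N]. *)
Lemma sum_theta_coef (G : nat -> R) N :
  \sum_(n < (N ^ 2).+1) theta_coef n * G n = \sum_(m < N.+1) sign_count m * G (m ^ 2)%N.
Proof.
set K := (N ^ 2).+1.
transitivity (\sum_(n < K) \sum_(m < K) (m ^ 2 == n)%N%:R * sign_count m * G n).
  by apply: eq_bigr => n _; rewrite (theta_coef_widen (ltn_ord n)) mulr_suml.
rewrite exchange_big /=.
have NK : (N.+1 <= K)%N by rewrite /K; nia.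
rewrite (big_ord_widen K (fun m => sign_count m * G (m ^ 2)%N))// [RHS]big_mkcond.
apply: eq_bigr => m _.
have -> : (m < N.+1)%N = (m ^ 2 < K)%N by rewrite /K !ltnS leq_exp2r.
case: ifPn => mK.
  rewrite (bigD1 (Ordinal mK))//= eqxx mul1r big1 ?addr0// => n nm.
  rewrite (_ : _ == _ = false) ?mul0r//; apply/negbTE.
  by apply: contra nm => /eqP mn; apply/eqP/val_inj.
rewrite big1// => n _; rewrite (_ : _ == _ = false) ?mul0r//; apply/negbTE.
by apply: contra mK => /eqP ->.
Qed.

Lemma theta_coef_bound n : `|theta_coef n| <= 2 * n.+1%:R.
Proof.
rewrite /theta_coef (le_trans (ler_norm_sum _ _ _))//.
rewrite mulr_natr -[X in _ *+ X](card_ord n.+1) -sumr_const; apply: ler_sum => m _.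
rewrite normrM normr_nat (ger0_norm (sign_count_ge0 _)).
have := sign_count_le2 m; have := sign_count_ge0 m; case: (_ == _); rewrite ?mul1r ?mul0r; lra.
Qed.

Lemma sum_abs_sym (F : nat -> R) N :
  \sum_(i < N.*2.+1) F `|i%:Z - N%:Z|%N = \sum_(m < N.+1) sign_count m * F m.
Proof.
rewrite -(big_mkord xpredT (fun i => F `|i%:Z - N%:Z|%N)) (@big_cat_nat _ _ _ N)//=; last lia.
rewrite big_nat_rev add0n (big_addn 0 _ N) /=.
have -> : (N.*2.+1 - N = N.+1)%N by lia.
rewrite big_nat_recl// big_ord_recl /sign_count /= mul1r.
rewrite (_ : `|(0 + N)%N%:Z - N%:Z|%N = 0)%N; last lia.
rewrite addrCA; congr (_ + _); rewrite -big_split /= big_mkord; apply: eq_bigr => i _.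
rewrite [X in F X + _](_ : _ = i.+1); last by have := ltn_ord i; lia.
rewrite [X in _ + F X](_ : _ = i.+1); last by lia.
by rewrite mulr_natl.
Qed.

Definition theta_partial (N : nat) (z : R) : R :=
  \sum_(i < N.*2.+1) z ^+ (`|i%:Z - N%:Z|%N ^ 2).

(** Partial sums of [z h'(z)]; divided by [theta_partial N z], the second moment of the truncated
    law proportional to [z ^ (r ^ 2)]. *)
Definition theta_moment (N : nat) (z : R) : R :=
  \sum_(i < N.*2.+1) (`|i%:Z - N%:Z|%N ^ 2)%:R * z ^+ (`|i%:Z - N%:Z|%N ^ 2).

Definition theta_sum (z : R) : R := limn (pseries theta_coef z).
Definition theta_sum' (z : R) : R := limn (pseries (pseries_diffs theta_coef) z).

Lemma theta_coef_bound1 n : `|theta_coef n| <= 2 * n.+1%:R ^+ 1.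
Proof. by rewrite expr1; exact: theta_coef_bound. Qed.

Lemma square_cvg_oo : (fun N : nat => (N ^ 2).+1) @ \oo --> \oo.
Proof.
move=> A [n _ nA]; exists n => // m /= nm; apply: nA => /=; nia.
Qed.

Lemma theta_partial_cvg (z : R) : `|z| < 1 -> theta_partial ^~ z @ \oo --> theta_sum z.
Proof.
move=> z1; have cv : cvgn (pseries theta_coef z).
  exact: is_cvg_pseries_poly z1 (pow_bound_weaken (_ : 1 <= 4)%N theta_coef_bound1).
have := cvg_comp _ _ square_cvg_oo cv; apply: cvg_trans; apply: near_eq_cvg; near=> N.
rewrite /theta_partial /pseries /series /= big_mkord (sum_theta_coef (fun n => z ^+ n)).
by rewrite -(sum_abs_sym (fun m => z ^+ (m ^ 2)))//.
Unshelve. all: by end_near. Qed.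

Lemma theta_moment_cvg (z : R) : `|z| < 1 -> theta_moment ^~ z @ \oo --> z * theta_sum' z.
Proof.
move=> z1; have cv : cvgn (pseries (pseries_diffs theta_coef) z).
  apply: is_cvg_pseries_poly z1 (pow_bound_weaken (_ : 2 <= 4)%N _) => //.
  exact: pseries_diffs_bound theta_coef_bound1.
have := cvg_comp _ _ square_cvg_oo (pseries_diffs_equiv cv).
move=> /(cvgMr (a := z)); apply: cvg_trans; apply: near_eq_cvg; near=> N.
rewrite /theta_moment (sum_abs_sym (fun m => (m ^ 2)%:R * z ^+ (m ^ 2))).
rewrite -(sum_theta_coef (fun n => n%:R * z ^+ n)).
rewrite /series /= big_mkord mulr_sumr; apply: eq_bigr => n _.
case: (n : nat) => [|m]; first by rewrite !mul0r !mulr0.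
by rewrite exprS /=; ring.
Unshelve. all: by end_near. Qed.

End jacobi.

(** * Existence and meaning of the critical point *)

Section critical_point.
Variable R : realType.
Implicit Types z : R.

Lemma jacobi_thetaE z : `|z| < 1 -> jacobi_theta z = theta_sum z.
Proof. by move=> z1; exact/cvg_lim/theta_partial_cvg. Qed.

Lemma theta_partial_nondecreasing z : 0 <= z ->
  nondecreasing_seq (theta_partial (R := R) ^~ z).
Proof.
move=> z0; apply/nondecreasing_seqP => N; rewrite /theta_partial.
rewrite !(sum_abs_sym (fun m => z ^+ (m ^ 2))) [leRHS]big_ord_recr /= lerDl.
by rewrite mulr_ge0 ?sign_count_ge0 ?exprn_ge0.
Qed.

Lemma theta_partial_le z N : 0 <= z < 1 -> theta_partial N z <= theta_sum z.
Proof.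
move=> /andP[z0 z1]; have zn : `|z| < 1 by rewrite ger0_norm.
rewrite -(cvg_lim _ (theta_partial_cvg zn))//.
apply: nondecreasing_cvgn_le; first exact: theta_partial_nondecreasing.
exact: cvgP (theta_partial_cvg zn).
Qed.

Lemma theta_sum_gt1 z : 0 < z < 1 -> 1 < theta_sum z.
Proof.
move=> /andP[z0 z1]; have h : 0 <= z < 1 by rewrite ltW.
apply: lt_le_trans (theta_partial_le 1 h).
rewrite /theta_partial (sum_abs_sym (fun m => z ^+ (m ^ 2))).
by rewrite !big_ord_recl big_ord0 /sign_count /=; lra.
Qed.

Lemma is_derive_theta_sum z : `|z| < 1 -> is_derive z (1 : R) (@theta_sum R) (theta_sum' z).
Proof.
move=> z1; apply: (is_derive_pseries z1 (C := 2)).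
exact: (pow_bound_weaken (_ : 1 <= 2)%N (@theta_coef_bound1 R)).
Qed.

Lemma continuous_theta_sum z : `|z| < 1 -> {for z, continuous (@theta_sum R)}.
Proof.
move=> /is_derive_theta_sum dz.
by apply/differentiable_continuous/derivable1_diffP; exact: ex_derive.
Qed.

Lemma continuous_theta_sum' z : `|z| < 1 -> {for z, continuous (@theta_sum' R)}.
Proof.
move=> z1.
have dz := is_derive_pseries z1 (pseries_diffs_bound (@theta_coef_bound1 R)).
by apply/differentiable_continuous/derivable1_diffP; exact: ex_derive.
Qed.

Lemma is_derive_l_gamma (g z : R) : 0 < z < 1 ->
  is_derive z (1 : R) (l_gamma g) (theta_sum' z / theta_sum z - g / z).
Proof.
move=> /[dup] z01 /andP[z0 z1]; have zn : `|z| < 1 by rewrite ger0_norm ?ltW.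
have f1 := theta_sum_gt1 z01.
apply: (@near_eq_is_derive _ _ _ (fun y => ln (theta_sum y) - g * ln y)).
  (* [jacobi_theta] is identified with the power series only inside the unit disc, so the derivative
     is transported along an equality valid near [z]. *)
  have nz : \forall y \near z, `|y| < 1.
    have nc : `|y| @[y --> z] --> `|z| by exact: norm_continuous.
    exact: (cvgr_lt _ nc).
  by apply: filterS nz => y y1; rewrite /l_gamma jacobi_thetaE.
have d1 := is_derive_theta_sum zn.
have d2 : is_derive (theta_sum z) (1 : R) (@ln R) (theta_sum z)^-1.
  by apply: is_derive1_ln; lra.
have d3 : is_derive z (1 : R) (@ln R) z^-1 by exact: is_derive1_ln.
have d4 : is_derive z (1 : R) (@ln R \o @theta_sum R) ((theta_sum z)^-1 * theta_sum' z).
  exact: is_derive1_comp.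
have d5 : is_derive z (1 : R) (fun y => g * ln y) (g / z).
  by apply: is_derive_eq; rewrite /GRing.scale /=; ring.
by apply: is_derive_eq; rewrite mulrC.
Qed.

(** The difference is the sum of [(r ^ 2 - gam) * b ^ (r ^ 2)] over [|r| <= N]. The point [b] is so
    close to 1 that, by Bernoulli's inequality, [b ^+ (N0 ^ 2) >= 1 / 2]. *)
Lemma theta_moment_gt (gam N : nat) : (0 < gam)%N ->
  let N0 := (gam.*2.+1)%N in
  let b : R := 1 - (2 * N0%:R ^+ 2)^-1 in
  (N0 <= N)%N -> 1 <= theta_moment N b - gam%:R * theta_partial N b.
Proof.
move=> gam0 N0 b N0N.
have N0R : N0%:R = 2 * gam%:R + 1 :> R by rewrite /N0 -addn1 natrD -mul2n natrM.
have g1 : 1 <= gam%:R :> R by rewrite ler1n.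
have N02 : 9 <= N0%:R ^+ 2 :> R by rewrite N0R; nra.
have b0 : 0 < b.
  rewrite /b subr_gt0 invf_lt1 ?mulr_gt0//; lra.
have b1 : b < 1 by rewrite /b ltrBlDr ltrDl invr_gt0; lra.
have bern n (x : R) : 0 <= x <= 1 -> 1 - n%:R * x <= (1 - x) ^+ n.
  move=> /andP[x0 x1]; elim: n => [|n IH]; first by rewrite mul0r subr0 expr0.
  have x10 : 0 <= 1 - x by lra.
  rewrite exprS; apply: le_trans (ler_wpM2l x10 IH).
  rewrite -natr1; have : 0 <= n%:R :> R by []. nra.
have bN : 1 / 2 <= b ^+ (N0 ^ 2).
  have := bern (N0 ^ 2)%N (2 * N0%:R ^+ 2)^-1.
  rewrite invr_ge0 invf_le1; last by lra.
  rewrite natrX => h; apply: le_trans (h _); last by apply/andP; split; lra.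
  rewrite invfM mulrCA mulfV ?mulr1; last by rewrite gt_eqF//; lra.
  lra.
rewrite /theta_moment /theta_partial (sum_abs_sym (fun m => (m ^ 2)%:R * b ^+ (m ^ 2))).
rewrite (sum_abs_sym (fun m => b ^+ (m ^ 2))) mulr_sumr -sumrB.
(* The two terms at distance [N0] contribute at least [N0 ^ 2 - gam], each [m < gam] costs at most
   [2 * gam], and all other terms are nonnegative. The total is at least [2 gam^2 + 3 gam + 1]. *)
pose lo (m : nat) : R := (m == N0)%:R * (N0%:R ^+ 2 - gam%:R) - (m < gam)%N%:R * (2 * gam%:R).
apply: (@le_trans _ _ (\sum_(m < N.+1) lo m)).
  have lN : (N0 < N.+1)%N by [].
  rewrite sumrB -!mulr_suml.
  have -> : \sum_(m < N.+1) (nat_of_ord m == N0)%:R = 1 :> R.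
    rewrite (bigD1 (Ordinal lN))//= eqxx big1 ?addr0// => m mN.
    by rewrite (_ : _ == _ = false)//; apply/negbTE; apply: contra mN => /eqP e; apply/eqP/val_inj.
  have -> : \sum_(m < N.+1) (m < gam)%N%:R = gam%:R :> R.
    have gN : (gam <= N.+1)%N by rewrite /N0 in N0N *; lia.
    transitivity (\sum_(m < gam) (1 : R)); last by rewrite sumr_const card_ord.
    rewrite (big_ord_widen N.+1 (fun=> 1 : R) gN) [RHS]big_mkcond; apply: eq_bigr => m _.
    by case: (m < gam)%N.
  rewrite mul1r N0R; nra.
apply: ler_sum => m _; rewrite /lo.
have w0 := sign_count_ge0 R m; have w2 := sign_count_le2 R m.
have p0 : 0 < b ^+ (m ^ 2) by rewrite exprn_gt0.
have p1 : b ^+ (m ^ 2) <= 1 by rewrite exprn_ile1 ?ltW.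
have -> : sign_count R m * ((m ^ 2)%:R * b ^+ (m ^ 2)) - gam%:R * (sign_count R m * b ^+ (m ^ 2))
  = sign_count R m * b ^+ (m ^ 2) * ((m ^ 2)%:R - gam%:R) by ring.
have [mN|mN] := eqVneq (m : nat) N0.
  have -> : (m < gam)%N = false by rewrite mN /N0; lia.
  rewrite mul0r subr0 mul1r /sign_count {1}mN /= natrX mN.
  have : gam%:R <= N0%:R ^+ 2 :> R by rewrite N0R; nra.
  nra.
rewrite mul0r sub0r; case: ltnP => mg.
  rewrite mul1r; have : 0 <= (m ^ 2)%:R :> R by [].
  have : 0 <= sign_count R m * b ^+ (m ^ 2) <= 2 by apply/andP; split; nra.
  move: (sign_count R m * _) => x /andP[x0 x2] s0.
  have : x * gam%:R <= 2 * gam%:R by rewrite ler_wpM2r.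
  nra.
rewrite mul0r oppr0; apply: mulr_ge0; first by apply: mulr_ge0 => //; exact: ltW.
by rewrite subr_ge0 ler_nat; nia.
Qed.

(** Intermediate value theorem for [S] on [[0, b]]: [S 0] is negative, and [S b >= 1] is the limit
    of [theta_moment_gt]. *)
Lemma exists_critical_point (gam : nat) : (0 < gam)%N ->
  exists2 z : R, 0 < z < 1 & z * theta_sum' z = gam%:R * theta_sum z.
Proof.
move=> gam0; pose N0 := (gam.*2.+1)%N; pose b : R := 1 - (2 * N0%:R ^+ 2)^-1.
have N01 : 1 <= N0%:R :> R by rewrite ler1n.
have b0 : 0 < b by rewrite /b subr_gt0 invf_lt1 ?mulr_gt0 ?exprn_gt0//; nra.
have b1 : b < 1 by rewrite /b ltrBlDr ltrDl invr_gt0 mulr_gt0 ?exprn_gt0//; lra.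
pose S (z : R) := z * theta_sum' z - gam%:R * theta_sum z.
have lt1 z : 0 <= z <= b -> `|z| < 1.
  by move=> /andP[z0 zb]; rewrite ger0_norm// (le_lt_trans zb).
have cS z : 0 <= z <= b -> {for z, continuous S}.
  move=> /lt1 zn; apply: cvgB.
    by apply: cvgM; [exact: cvg_id|exact: continuous_theta_sum'].
  by apply: cvgM; [exact: cvg_cst|exact: continuous_theta_sum].
have Sb : 1 <= S b.
  have bn : `|b| < 1 by apply: lt1; rewrite ltW/=.
  have cv : theta_moment N b - gam%:R * theta_partial N b @[N --> \oo] --> S b.
    apply: cvgB; first exact: theta_moment_cvg.
    by apply: cvgMr; exact: theta_partial_cvg.
  rewrite -(cvg_lim _ cv)//; apply: limr_ge; first exact: cvgP cv.
  by exists N0 => // N /= N0N; exact: theta_moment_gt.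
have S0 : S 0 < 0.
  rewrite /S mul0r sub0r oppr_lt0 mulr_gt0 ?ltr0n// (lt_le_trans ltr01)//.
  have h : 0 <= (0 : R) < 1 by rewrite lexx ltr01.
  apply: le_trans (theta_partial_le 0 h).
  by rewrite /theta_partial big_ord_recl big_ord0 /= addr0.
have [z zb Sz] : exists2 z, z \in `[0, b] & S z = 0.
  apply: IVT; first exact: ltW.
    apply: continuous_in_subspaceT => z; rewrite inE /= in_itv /=; exact: cS.
  by rewrite ge_min le_max (ltW S0) /=; apply/orP; right; lra.
move: zb; rewrite in_itv /= => /andP[z0 zb].
exists z; last by apply/eqP; rewrite -subr_eq0 -/(S z) Sz.
rewrite (le_lt_trans zb b1) andbT lt_neqAle z0 andbT.
by apply/eqP => z0'; rewrite -z0' in Sz; rewrite Sz ltxx in S0.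
Qed.

(** Vanishing of the derivative of [l_gamma] is the moment identity after clearing denominators. The
    existence of a critical point excludes the default value of [xget]. *)
Lemma z_gammaP (gam : nat) (z := z_gamma (gam%:R : R)) : (0 < gam)%N ->
  0 < z < 1 /\ z * theta_sum' z = gam%:R * theta_sum z.
Proof.
move=> gam0.
have dl (y : R) : 0 < y < 1 -> derive1 (l_gamma (gam%:R : R)) y =
    theta_sum' y / theta_sum y - gam%:R / y.
  by move=> y01; rewrite derive1E; have [_ ->] := is_derive_l_gamma gam%:R y01.
have crit (y : R) : 0 < y < 1 -> (theta_sum' y / theta_sum y - gam%:R / y == 0) =
    (y * theta_sum' y == gam%:R * theta_sum y).
  move=> /[dup] y01 /andP[y0 _]; have f1 := theta_sum_gt1 y01.
  have f0 : theta_sum y != 0 by rewrite gt_eqF// (lt_trans ltr01).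
  by rewrite subr_eq0 eqr_div ?(gt_eqF y0)// mulrC.
rewrite /z /z_gamma; case: xgetP => [y _ /= [y01]|no].
  by rewrite dl// => /eqP; rewrite crit// => /eqP.
have [y y01 ye] := exists_critical_point gam0.
by case: (no y); split=> //; apply/eqP; rewrite dl// crit//; apply/eqP.
Qed.

Lemma theta_moment_z_gamma (gam : nat) (z := z_gamma (gam%:R : R)) : (0 < gam)%N ->
  [/\ 0 < z < 1, 1 < jacobi_theta z,
      @theta_partial R ^~ z @ \oo --> jacobi_theta z &
      @theta_moment R ^~ z @ \oo --> gam%:R * jacobi_theta z].
Proof.
move=> /z_gammaP; rewrite -/z => -[z01 ze].
have zn : `|z| < 1 by case/andP: z01 => z0 z1; rewrite ger0_norm ?ltW.
rewrite jacobi_thetaE// -ze; split=> //.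
- exact: theta_sum_gt1.
- exact: theta_partial_cvg.
- exact: theta_moment_cvg.
Qed.

End critical_point.

Section count.
Variable R : realType.

(** An exponential Markov bound: the total weight of a box containing the counted vectors is a power
    of a partial sum of the theta series, hence at most [jacobi_theta z ^+ l]. *)
Lemma lattice_count_le (l gam : nat) (z : R) : 0 < z < 1 ->
  (lattice_count l (gam%:R : R))%:R * z ^+ (gam * l) <= jacobi_theta z ^+ l.
Proof.
move=> z01; have /andP[z0 z1] := z01.
have zn : `|z| < 1 by rewrite ger0_norm ?ltW.
have h1 := theta_sum_gt1 z01; rewrite jacobi_thetaE//.
rewrite /lattice_count; set A := [set k | _]; set M := (gam * l)%N.
(* For an infinite set [fset_set] is empty, so the count would be 0 and the bound holds. *)
have [finA|infA] := pselect (finite_set A); last first.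
  rewrite /fset_set; case: pselect => // _.
  by rewrite cardfs0 mul0r exprn_ge0//; lra.
have AM k : A k -> (\sum_(i < l) `|k i|%N ^ 2 <= M)%N.
  move=> [kM _]; rewrite -(ler_nat R) /M natrM natr_sum; apply: le_trans kM.
  rewrite le_eqVlt; apply/orP; left; apply/eqP; apply: eq_bigr => i _.
  by rewrite natrX -normr_nat natr_absz intr_norm normr_id real_normK ?num_real.
have kiM k i : A k -> (`|k i|%N <= M)%N.
  move=> /AM; rewrite (bigD1 i)//= => h; have : (`|k i|%N <= `|k i|%N ^ 2)%N by nia.
  lia.
(* Coordinates lie between [- M] and [M]; adding [M] encodes them in an ordinal, centred as in the
   partial sums of the theta series. *)
pose phi (k : {ffun 'I_l -> int}) : {ffun 'I_l -> 'I_(M.*2.+1)} :=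
  [ffun i => inord `|(k i + M%:Z)%R|%N].
have phiE k i : A k -> `|(phi k i)%:Z - M%:Z|%N = `|k i|%N /\ (phi k i)%:Z - M%:Z = k i.
  move=> Ak; have := kiM k i Ak; rewrite /phi ffunE => h.
  rewrite inordK; last by lia.
  by split; lia.
have phi_inj : {in fset_set A &, injective phi}.
  move=> k k'; rewrite !in_fset_set// !inE => Ak Ak' e; apply/ffunP => i.
  by rewrite -(phiE k i Ak).2 -(phiE k' i Ak').2 e.
pose G (x : {ffun 'I_l -> 'I_(M.*2.+1)}) : R :=
  \prod_i z ^+ (`|(x i)%:Z - M%:Z|%N ^ 2).
have G0 x : 0 <= G x by apply: prodr_ge0 => i _; rewrite exprn_ge0// ltW.
(* Each counted k has sum of squares at most M, hence weight at least z ^ M. *)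
apply: (@le_trans _ _ (\sum_(k <- fset_set A) G (phi k))).
  rewrite mulr_natl.
  have -> : z ^+ M *+ #|` fset_set A|%fset = \sum_(k <- fset_set A) z ^+ M.
    by rewrite big_const_seq count_predT iter_addr addr0.
  rewrite big_seq [leRHS]big_seq; apply: ler_sum => k; rewrite in_fset_set// inE => Ak.
  rewrite /G; under eq_bigr do rewrite (phiE _ _ Ak).1.
  by rewrite -expr_sum ler_wiXn2l ?ltW// AM.
rewrite -(big_map phi xpredT G).
apply: (@le_trans _ _ (\sum_x G x)).
  rewrite big_uniq /=; last by rewrite map_inj_in_uniq ?fset_uniq.
  by rewrite [leRHS](bigID (mem (map phi (fset_set A))))/= lerDl sumr_ge0.
rewrite (sum_prod_ffun l (fun i : 'I_(M.*2.+1) => z ^+ (`|i%:Z - M%:Z|%N ^ 2))).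
apply: lerXn2r; rewrite ?nnegrE; last by apply: (theta_partial_le M); rewrite ltW.
- by apply: sumr_ge0 => i _; rewrite exprn_ge0// ltW.
- lra.
Qed.

End count.

(** * A rich symmetric set of frequencies *)

Section perturbation.
Variable R : realType.

Definition radius (N : nat) (i : 'I_(N.*2.+1)) : nat := `|i%:Z - N%:Z|%N.

(* Moving mass delta from 0 to {-1, 1} raises both the second moment and the
   probability of being nonzero by delta; since vartheta > 1 this creates slack in
   the moment constraint, and it raises the entropy by - delta * ln z at first order. *)
Let transfer (m : nat) : R := if m == 0%N then -1 else if m == 1%N then 1 / 2 else 0.

Let sum_transfer (N : nat) (G : nat -> R) : (0 < N)%N ->
  \sum_(i < N.*2.+1) transfer (radius i) * G (radius i) = G 1%N - G 0%N.
Proof.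
case: N => // N _; rewrite (sum_abs_sym (fun m => transfer m * G m)).
rewrite 2!big_ord_recl big1; first by rewrite /transfer /sign_count /=; lra.
by move=> i _; rewrite /transfer /= mul0r mulr0.
Qed.

(** The number [ln h - g * ln z] is the entropy of the full law on the integers. The law is
    truncated to [|r| <= N] and perturbed by [delta]; each limiting inequality is strict, so it
    persists for some finite [N]. *)
Lemma exists_perturbed_distribution (z h g vartheta : R) :
  0 < z < 1 -> 1 < h ->
  @theta_partial R ^~ z @ \oo --> h -> @theta_moment R ^~ z @ \oo --> g * h ->
  g * h <= vartheta * (h - 1) -> 1 < vartheta ->
  exists (N : nat) (q : 'I_(N.*2.+1) -> R) (eta : R),
  [/\ (forall i, 0 < q i) /\ \sum_i q i = 1, 0 < eta,
      \sum_i q i * ((radius i ^ 2)%:R - vartheta * (radius i != 0%N)%:R) < 0 &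
      \sum_i q i * (ln (q i) + (ln h - g * ln z) + eta) < 0].
Proof.
move=> /andP[z0 z1] h1 cH cm gh v1.
have lz : ln z < 0 by rewrite ln_lt0// z0.
have h0 : 0 < h by lra.
(* The second-order cost of the perturbation tends to [delta ^+ 2 * C]. The choice of [delta] keeps
   the mass at 0 positive and makes this cost at most half of the gain [- delta * ln z]; [eta]
   spends a further quarter. *)
pose C := h * (1 + (2 * z)^-1).
have iz : 0 < (2 * z)^-1 by rewrite invr_gt0 mulr_gt0.
have hC : h < C by rewrite /C; nra.
pose delta := Num.min (1 / 2) (- ln z / 2) / C.
pose eta := - (delta * ln z) / 4.
have d0 : 0 < delta.
  by rewrite divr_gt0//; [rewrite lt_min; apply/andP; split; lra|lra].
have dC1 : delta * C <= 1 / 2 by rewrite /delta divfK ?gt_eqF ?ge_min ?lexx//; lra.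
have dC2 : delta * C <= - ln z / 2.
  by rewrite /delta divfK ?gt_eqF ?ge_min ?lexx ?orbT//; lra.
have eta0 : 0 < eta by rewrite /eta; nra.
have hne0 : h != 0 by rewrite gt_eqF.
have cHi : (theta_partial N z)^-1 @[N --> \oo] --> h^-1 by exact: cvgV.
have cmH : theta_moment N z / theta_partial N z @[N --> \oo] --> g.
  by rewrite -[g](mulfK hne0); exact: cvgM.
have cln : ln (theta_partial N z) @[N --> \oo] --> ln h.
  by apply: (continuous_cvg _ _ cH); exact: continuous_ln.
have n1 : \forall N \near \oo, 1 < theta_partial N z by exact: (cvgr_gt _ cH).
have n2 : \forall N \near \oo, delta * theta_partial N z < 1.
  apply: (cvgr_lt (delta * h)); first exact: cvgMr.
  nra.
have n3 : \forall N \near \oo, theta_moment N z / theta_partial N z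
    - vartheta * (1 - (theta_partial N z)^-1) < delta * (vartheta - 1).
  apply: (cvgr_lt (g - vartheta * (1 - h^-1))).
    by apply: cvgB => //; apply: cvgMr; apply: cvgB => //; exact: cvg_cst.
  apply: (@le_lt_trans _ _ 0); last by rewrite mulr_gt0//; lra.
  rewrite subr_le0 -(ler_pM2r h0) -mulrA mulrBl mul1r mulVf//.
have n4 : \forall N \near \oo, ln z * (theta_moment N z / theta_partial N z + delta)
    - ln (theta_partial N z) + delta ^+ 2 * (theta_partial N z * (1 + (2 * z)^-1))
    + (ln h - g * ln z) + eta < 0.
  apply: (cvgr_lt (ln z * (g + delta) - ln h + delta ^+ 2 * (h * (1 + (2 * z)^-1))
    + (ln h - g * ln z) + eta)).
    apply: cvgD; last exact: cvg_cst.
    apply: cvgD; last exact: cvg_cst.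
    apply: cvgD.
      apply: cvgB => //; apply: cvgMr; apply: cvgD => //; exact: cvg_cst.
    by apply: cvgMr; apply: cvgMl.
  by rewrite -/C /eta; nra.
have n0 : \forall N \near \oo, (0 < N)%N by exists 1%N.
have [N [N0 [H1 [H2 [H3 H4]]]]] := filter_ex (filterI n0 (filterI n1 (filterI n2 (filterI n3 n4)))).
rewrite /= in H1 H2 H3 H4.
set H := theta_partial N z in H1 H2 H3 H4; set m := theta_moment N z in H3 H4.
have H0 : 0 < H by lra.
have Hne0 : H != 0 by rewrite gt_eqF.
pose p (a : nat) := z ^+ (a ^ 2) / H.
pose q (i : 'I_(N.*2.+1)) := p (radius i) + delta * transfer (radius i).
have p0 a : 0 < p a by rewrite divr_gt0// exprn_gt0.
have q0 i : 0 < q i.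
  rewrite /q /transfer; case: (radius i) => [|[|a]] /=.
  - rewrite /p expr0 mul1r mulrN1 subr_gt0 -(ltr_pM2r H0) mulVf//.
  - have := p0 1%N; nra.
  - by rewrite mulr0 addr0.
have sumq (G : nat -> R) : \sum_i q i * G (radius i) =
    (\sum_i z ^+ (@radius N i ^ 2) * G (radius i)) / H + delta * (G 1%N - G 0%N).
  rewrite -(@sum_transfer N G N0) mulr_suml mulr_sumr -big_split /=; apply: eq_bigr => i _.
  by rewrite /q /p; ring.
have sq1 : \sum_i q i = 1.
  transitivity (\sum_i q i * 1); first by apply: eq_bigr => i _; rewrite mulr1.
  rewrite (sumq (fun=> 1)) subrr mulr0 addr0; under eq_bigr do rewrite mulr1.
  by rewrite -/(theta_partial N z) divff.
exists N, q, eta; split=> //.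
- rewrite (sumq (fun a => (a ^ 2)%:R - vartheta * (a != 0%N)%:R)).
  have -> : \sum_i z ^+ (@radius N i ^ 2) * ((radius i ^ 2)%:R - vartheta * (radius i != 0%N)%:R)
      = m - vartheta * (H - 1).
    have -> : H - 1 = \sum_i z ^+ (@radius N i ^ 2) * (radius i != 0%N)%:R.
      rewrite /H /theta_partial (sum_abs_sym (fun a => z ^+ (a ^ 2))).
      rewrite (sum_abs_sym (fun a => z ^+ (a ^ 2) * (a != 0%N)%:R)).
      rewrite !big_ord_recl /= mulr0 mulr0 add0r /sign_count /= expr0 mulr1 addrC addKr.
      by apply: eq_bigr => i _; rewrite mulr1.
    by rewrite /m /theta_moment mulr_sumr -sumrB; apply: eq_bigr => i _; rewrite /radius; ring.
  rewrite [X in delta * X](_ : _ = 1 - vartheta); last by rewrite /= mulr0 mulr1 !subr0.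
  have -> : (m - vartheta * (H - 1)) / H = m / H - vartheta * (1 - H^-1) by field.
  lra.
(* From [ln x <= x - 1] at [x = q i / p a]; the error [q * (q / p - 1)] is a linear term, of total
   zero, plus a chi-square term. *)
have key i : q i * (ln (q i) + (ln h - g * ln z) + eta) <=
    q i * ((radius i ^ 2)%:R * ln z - ln H + (ln h - g * ln z) + eta) +
    transfer (radius i) * (delta + delta ^+ 2 * (transfer (radius i) / p (radius i))).
  set a := radius i; have pa := p0 a; have qi := q0 i.
  have lnp : ln (p a) = (a ^ 2)%:R * ln z - ln H.
    rewrite /p ln_div ?posrE ?exprn_gt0// lnXn//; by rewrite mulr_natl.
  have qp : 0 < q i / p a by rewrite divr_gt0.
  have := le_ln1Dx (x := q i / p a - 1).
  rewrite addrCA subrr addr0 ln_div ?posrE// lnp => hl.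
  have {}hl : ln (q i) - ((a ^ 2)%:R * ln z - ln H) <= q i / p a - 1 by apply: hl; lra.
  have := ler_wpM2l (ltW qi) hl.
  have -> : q i * (q i / p a - 1) =
     transfer a * (delta + delta ^+ 2 * (transfer a / p a)).
    by rewrite /q -/a; field; rewrite gt_eqF.
  lra.
apply: (le_lt_trans (ler_sum _ (fun i _ => key i))).
rewrite big_split /= (sumq (fun a => (a ^ 2)%:R * ln z - ln H + (ln h - g * ln z) + eta)).
rewrite (@sum_transfer N (fun a => delta + delta ^+ 2 * (transfer a / p a)) N0).
set K := - ln H + (ln h - g * ln z) + eta.
have -> : \sum_i z ^+ (@radius N i ^ 2) *
    ((radius i ^ 2)%:R * ln z - ln H + (ln h - g * ln z) + eta) = m * ln z + H * K.
  rewrite /m /H /theta_moment /theta_partial !mulr_suml -big_split /=.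
  by apply: eq_bigr => i _; rewrite /K /radius; ring.
rewrite /transfer /p /= expr0 !expr1.
apply: le_lt_trans H4; rewrite le_eqVlt; apply/orP; left; apply/eqP.
by rewrite /K /=; field; rewrite Hne0 gt_eqF.
Qed.

End perturbation.

Section rich_set.
Variables (R : realType) (I : finType).

(** Transposing two coordinates permutes [F], so the sum of [phi (k i)] over [F] is the same for
    every [i]. *)
Lemma sum_symmetric d (F : {set {ffun 'I_d -> I}}) (phi : I -> R) (j : 'I_d) :
  (forall (s : 'S_d) k, k \in F -> [ffun i => k (s i)] \in F) ->
  d%:R * \sum_(k in F) phi (k j) = \sum_(k in F) \sum_i phi (k i).
Proof.
move=> symF; rewrite exchange_big /=.
have same i : \sum_(k in F) phi (k i) = \sum_(k in F) phi (k j).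
  pose sw (k : {ffun 'I_d -> I}) : {ffun 'I_d -> I} := [ffun a => k (tperm i j a)].
  have swK : involutive sw by move=> k; apply/ffunP => a; rewrite !ffunE tpermK.
  rewrite [RHS](reindex_inj (inv_inj swK)) /=; apply: eq_big => [k|k _].
    apply/idP/idP => [/(symF (tperm i j))//|/(symF (tperm i j))].
    by rewrite -/(sw (sw k)) swK.
  by rewrite ffunE tpermR.
under [RHS]eq_bigr do rewrite same.
by rewrite sumr_const card_ord mulr_natl.
Qed.

(** With [x = d * eta / 4], the exponential is at least [x ^ 4], that is [d^2 (d eta^2)^2 / 256],
    and [32 ^ 2 / 256 = 4]. *)
Lemma expR_ge_sqr (eta : R) (d : nat) : 0 < eta -> 32 / eta ^+ 2 <= d%:R ->
  4 * d%:R ^+ 2 <= expR (d%:R * eta).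
Proof.
move=> e0 hd; have d0 : 0 <= d%:R :> R by [].
have -> : expR (d%:R * eta) = expR (d%:R * eta / 4) ^+ 4.
  by rewrite -expRM_natr; congr expR; lra.
pose x := d%:R * eta / 4.
have x0 : 0 <= x by rewrite divr_ge0// mulr_ge0// ltW.
have ex : x ^+ 4 <= expR x ^+ 4.
  rewrite lerXn2r// ?nnegrE ?expR_ge0//; have := expR_ge1Dx x; lra.
apply: le_trans ex; rewrite (_ : x ^+ 4 = d%:R ^+ 2 * (d%:R * eta ^+ 2) ^+ 2 / 256); last first.
  by rewrite /x; field.
have h32 : 32 <= d%:R * eta ^+ 2 by rewrite -ler_pdivrMr// exprn_gt0.
have : 32 ^+ 2 <= (d%:R * eta ^+ 2) ^+ 2 by rewrite lerXn2r ?nnegrE//; lra.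
have := sqr_ge0 (d%:R : R); nra.
Qed.

Variables (rad : I -> nat) (q : I -> R) (vartheta lam eta : R).
Hypothesis q_gt0 : forall i, 0 < q i.
Hypothesis q_sum : \sum_i q i = 1.
Hypothesis eta_gt0 : 0 < eta.
Hypothesis mean1 : \sum_i q i * ((rad i ^ 2)%:R - vartheta * (rad i != 0%N)%:R) < 0.
Hypothesis mean2 : \sum_i q i * (ln (q i) + lam + eta) < 0.

(** [F] consists of the vectors with negative empirical sums of [u1] and [u2]; by [chernoff] it has
    mass at least 1/2 for large [d]. The sign for [u2] caps the mass of each element and so forces
    [F] to be large; the sign for [u1], averaged over coordinates by symmetry, is the moment
    constraint. *)
Lemma exists_rich_set : exists D0 : nat, forall d : nat, (D0 < d)%N ->
  exists (F : {set {ffun 'I_d -> I}}) (m : nat),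
  [/\ (0 < m)%N,
      forall j, #|[set k in F | rad (k j) != 0%N]| = m,
      forall j, \sum_(k in F) (rad (k j) ^ 2)%:R <= vartheta * m%:R &
      2 * #|F|%:R * expR (d%:R * lam) <= m%:R ^+ 2].
Proof.
pose u1 i := (rad i ^ 2)%:R - vartheta * (rad i != 0%N)%:R.
pose u2 i := ln (q i) + lam + eta.
have q_ge0 i : 0 <= q i by exact: ltW.
have [rho1 [r10 r11 tail1]] := chernoff q_ge0 q_sum mean1.
have [rho2 [r20 r21 tail2]] := chernoff q_ge0 q_sum mean2.
have small rho : 0 <= rho -> rho < 1 -> \forall d \near \oo, rho ^+ d < 1 / 4 :> R.
  move=> rho0 rho1'; have /cvg_geometric : `|rho| < 1 by rewrite ger0_norm.
  move=> /(_ 1) /(cvgr_lt 0) /(_ (1 / 4)) h.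
  have : \forall d \near \oo, geometric 1 rho d < 1 / 4 by apply: h; lra.
  by apply: filterS => d; rewrite /= mul1r.
have big : \forall d \near \oo, 32 / eta ^+ 2 <= d%:R :> R.
  exact: nbhs_infty_ger.
have [D0 _ D0P] := filterI (small _ r10 r11) (filterI (small _ r20 r21) big).
exists D0 => d dD0.
have [/= s1 [s2 hd]] := D0P d (ltnW dD0).
have d0 : 0 < d%:R :> R by rewrite ltr0n (leq_ltn_trans _ dD0).
pose F := [set k : {ffun 'I_d -> I} | (\sum_j u1 (k j) < 0) && (\sum_j u2 (k j) < 0)]%SET.
have symF (s : 'S_d) k : k \in F -> [ffun i => k (s i)] \in F.
  have sE (u : I -> R) : \sum_j u ([ffun i => k (s i)] j) = \sum_j u (k j).
    rewrite [RHS](reindex_inj (@perm_inj _ s)); apply: eq_bigr => j _.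
    by rewrite ffunE.
  by rewrite !inE !sE.
pose prod_q (k : {ffun 'I_d -> I}) := \prod_j q (k j).
have pq0 k : 0 < prod_q k by apply: prodr_gt0.
have massF : 1 / 2 <= \sum_(k in F) prod_q k.
  have tot : \sum_k prod_q k = 1 by rewrite /prod_q sum_prod_ffun q_sum expr1n.
  have := le_trans (tail1 d) (ltW s1); have := le_trans (tail2 d) (ltW s2).
  have : \sum_k prod_q k <= \sum_(k in F) prod_q k +
      \sum_(k : {ffun 'I_d -> I} | 0 <= \sum_j u1 (k j)) prod_q k +
      \sum_(k : {ffun 'I_d -> I} | 0 <= \sum_j u2 (k j)) prod_q k.
    have mk (Q : pred {ffun 'I_d -> I}) :
      \sum_(k | Q k) prod_q k = \sum_k (if Q k then prod_q k else 0) by exact: big_mkcond.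
    rewrite (mk (fun k => k \in F)) (mk (fun k => 0 <= \sum_j u1 (k j))).
    rewrite (mk (fun k => 0 <= \sum_j u2 (k j))) -!big_split /=; apply: ler_sum => k _.
    have := pq0 k; rewrite inE; case: (ltP _ 0) => _; case: (ltP _ 0) => _ /=; lra.
  rewrite tot /prod_q /u1 /u2; lra.
have cardF : expR (d%:R * (lam + eta)) <= 2 * #|F|%:R.
  have le k : k \in F -> prod_q k <= expR (- (d%:R * (lam + eta))).
    rewrite inE => /andP[_ h].
    have -> : prod_q k = expR (\sum_j ln (q (k j))).
      by rewrite expR_sum; apply: eq_bigr => j _; rewrite lnK// posrE.
    rewrite ler_expR; move: h; rewrite /u2.
    under eq_bigr do rewrite -addrA.
    rewrite big_split /= sumr_const card_ord -[(lam + eta) *+ d]mulr_natl; lra.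
  have : \sum_(k in F) prod_q k <= #|F|%:R * expR (- (d%:R * (lam + eta))).
    by rewrite mulr_natl -sumr_const; exact: ler_sum.
  rewrite expRN => h; have := le_trans massF h.
  rewrite ler_pdivlMr ?expR_gt0//; lra.
pose m := #|[set k in F | rad (k (Ordinal (leq_ltn_trans (leq0n _) dD0))) != 0%N]|.
have countE j : (#|[set k in F | rad (k j) != 0%N]|)%:R = \sum_(k in F) (rad (k j) != 0%N)%:R :> R.
  by rewrite -natr_sum cardsE -sum1_card big_mkcondr; congr (_%:R);
    apply: eq_bigr => k _; case: (_ != _).
have sameE j : #|[set k in F | rad (k j) != 0%N]| = m.
  apply/eqP; rewrite -(eqr_nat R) !countE; apply/eqP/(mulfI (lt0r_neq0 d0)).
  by rewrite !(sum_symmetric (fun i => (rad i != 0%N)%:R) _ symF).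
have mE : d%:R * m%:R = \sum_(k in F) \sum_i (rad (k i) != 0%N)%:R :> R.
  by rewrite /m countE (sum_symmetric (fun i => (rad i != 0%N)%:R) _ symF).
(* A vector of [F] is nonzero, since the zero vector has [u1]-sum 0 and the inequality defining [F]
   is strict. *)
have Fm : #|F|%:R <= d%:R * m%:R :> R.
  rewrite mE -sumr_const; apply: ler_sum => k; rewrite inE => /andP[h _].
  have [i ri] : exists i, rad (k i) != 0%N.
    apply/existsP; apply: contraLR h; rewrite negb_exists => /forallP r0.
    rewrite big1 ?ltxx// => j _; rewrite /u1; have := r0 j; rewrite negbK => /eqP ->.
    by rewrite mulr0 subr0.
  by rewrite (bigD1 i)//= ri lerDl sumr_ge0.
have F0 : 0 < #|F|%:R :> R by have := expR_gt0 (d%:R * (lam + eta)); lra.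
have m0 : 0 < m%:R :> R by rewrite -(pmulr_rgt0 _ d0) (lt_le_trans F0).
exists F, m; split=> //.
- by rewrite -(ltr0n R).
- move=> j; rewrite -(ler_pM2l d0) (sum_symmetric (fun i => (rad i ^ 2)%:R) _ symF).
  rewrite mulrCA mE mulr_sumr; apply: ler_sum => k; rewrite inE => /andP[h _].
  by move: h; rewrite /u1 sumrB -mulr_sumr subr_lt0 => /ltW.
have ee := expR_ge_sqr eta_gt0 hd.
have e0 := expR_gt0 (d%:R * lam).
(* The surplus factor [expR (d * eta)] pays for the factor [d ^ 2] lost in squaring
   [#|F| <= d * m]. *)
have le2 : 4 * d%:R ^+ 2 * expR (d%:R * lam) <= 2 * #|F|%:R.
  apply: le_trans cardF; rewrite mulrDr expRD mulrC ler_pM2l//.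
rewrite -(ler_pM2l (exprn_gt0 2 d0)).
have : #|F|%:R ^+ 2 <= (d%:R * m%:R) ^+ 2 :> R by rewrite lerXn2r ?nnegrE ?mulr_ge0// ltW.
rewrite exprMn; apply: le_trans.
have h := ler_wpM2r (ltW F0) le2; lra.
Qed.

End rich_set.

(** * The two lower bounds *)

(** After multiplication by [k!], the products compare factor by factor:
    [n (k - i) <= k (n - i)]. *)
Lemma expn_le_binomial (n k : nat) : (k <= n)%N -> (n ^ k <= k ^ k * 'C(n, k))%N.
Proof.
move=> kn; rewrite -(leq_pmul2r (fact_gt0 k)) -mulnA bin_ffact -[k`!]ffactnn !ffact_prod.
have prodE m : (m ^ k = \prod_(i < k) m)%N by rewrite prod_nat_const card_ord.
rewrite !prodE -!big_split /=; apply: leq_prod => i _.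
by have := ltn_ord i; nia.
Qed.

Lemma ln_binomial_ge (R : realType) (n k : nat) : (0 < k)%N -> (k <= n)%N ->
  k%:R * ln (n%:R / k%:R) <= ln ('C(n, k)%:R : R).
Proof.
move=> k0 kn; have n0 : (0 < n)%N by exact: leq_trans kn.
have k0R : 0 < k%:R :> R by rewrite ltr0n.
have n0R : 0 < n%:R :> R by rewrite ltr0n.
rewrite mulr_natl -lnXn ?divr_gt0// ler_ln ?posrE ?exprn_gt0 ?divr_gt0// ?ltr0n ?bin_gt0//.
rewrite expr_div_n ler_pdivrMr ?exprn_gt0// mulrC -!natrX -natrM ler_nat.
exact: expn_le_binomial.
Qed.

Section embedding.
Variables (d dstar : nat) (J : {set 'I_d}).
Hypothesis cardJ : #|J| = dstar.

(* The coordinates of k are placed, in increasing order, at the positions in J. *)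
Definition embed (k : {ffun 'I_dstar -> int}) : {ffun 'I_d -> int} :=
  [ffun j => if insub (index j (enum J)) is Some i then k i else 0].

Lemma embed_out k j : j \notin J -> embed k j = 0.
Proof.
move=> jJ; rewrite ffunE insubF//; apply/negbTE.
by rewrite -cardJ cardE index_mem mem_enum.
Qed.

Lemma embed_in j : j \in J -> exists i, forall k, embed k j = k i.
Proof.
move=> jJ; have lt : (index j (enum J) < dstar)%N by rewrite -cardJ cardE index_mem mem_enum.
by exists (Ordinal lt) => k; rewrite ffunE insubT.
Qed.

Lemma embed_onto i : exists j, forall k, embed k j = k i.
Proof.
have lt : (i < size (enum J))%N by rewrite -cardE cardJ.
have [j0 _] : exists j, j \in J by apply/card_gt0P; rewrite cardJ (leq_ltn_trans _ (ltn_ord i)).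
exists (nth j0 (enum J) i) => k; rewrite ffunE index_uniq ?enum_uniq//.
rewrite (insubT (fun m => m < dstar)%N (ltn_ord i)) /=.
by congr (k _); exact: val_inj.
Qed.

Lemma embed_inj : injective embed.
Proof.
move=> k k' kk'; apply/ffunP => i; have [j ej] := embed_onto i.
by rewrite -!ej kk'.
Qed.

End embedding.

Lemma minimax_one_frequency (R : realType) (kappa L alpha : R) (n d dstar : nat)
    (dO : measure_display) (Omega : measurableType dO)
    (P : probability Omega R) (xi : {ffun 'I_d -> int} -> {RV P >-> R}) :
  0 < kappa -> kappa <= L -> 0 < alpha -> (0 < n)%N -> (1 <= dstar <= d)%N ->
  (3 <= 'C(d, dstar))%N ->
  kappa / alpha <= dstar%:R * ln (d%:R / dstar%:R) / n%:R ->
  iid_standard_normal xi ->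
  ((1 / 2 - alpha)%:E <= minimax_error dstar n kappa L xi)%E.
Proof.
move=> k0 kL a0 n0 /andP[s1 sd] N3 hyp xi_iid.
have n0R : 0 < n%:R :> R by rewrite ltr0n.
pose kap (J : {set 'I_d}) (_ : unit) : {ffun 'I_d -> int} := [ffun j => (j \in J)%:R].
have unitE (G : unit -> R) : \sum_e G e = G tt.
  by rewrite (bigD1 tt)//= big1 ?addr0//; case.
apply: (@minimax_lower_bound _ _ _ _ _ _ _ _ _ _ _ xi_iid unit unit kap
  (fun _ _ => Num.sqrt kappa)) => //.
- exact: ltW.
- by rewrite card_unit.
- by move=> J _ [] [].
- by move=> J e j _ jJ; rewrite ffunE (negbTE jJ).
- by move=> J w j _ jJ; rewrite big_mkcond unitE ffunE jJ /= sqr_sqrtr ?(ltW k0).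
- move=> J w j _; rewrite unitE ffunE sqr_sqrtr ?(ltW k0)//; apply: le_trans kL.
  by case: (j \in J); rewrite /= ?expr1n ?mul1r// expr0n mul0r ltW.
- rewrite !unitE card_unit expr1n mul1r ler_expR -expr2 sqr_sqrtr ?(ltW k0)//.
  apply: (@le_trans _ _ (alpha * (dstar%:R * ln (d%:R / dstar%:R)))).
    by move: hyp; rewrite ler_pdivlMr// mulrAC ler_pdivrMr// mulrC [_ * alpha]mulrC.
  by rewrite ler_pM2l// ln_binomial_ge.
Qed.

Section rademacher.
Variables (R : realType) (E : finType).

(** For each fixed [w], the sum over [w'] factors into hyperbolic cosines. By [cosh_le] each is
    bounded by a quantity in which the sign [w e] disappears. *)
Lemma rademacher_second_moment (F : {set E}) (t a : R) :
  \sum_(w : {ffun E -> bool}) \sum_(w' : {ffun E -> bool})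
    expR (t * \sum_e (a * (e \in F)%:R * (-1) ^+ w e) * (a * (e \in F)%:R * (-1) ^+ w' e)) <=
  #|{ffun E -> bool}|%:R ^+ 2 * expR (2 * (t * a ^+ 2) ^+ 2 * #|F|%:R).
Proof.
rewrite expr2 -mulrA mulr_natl -[X in X <= _]mulr1 mulr1 -sumr_const.
apply: ler_sum => w _.
pose x e : R := t * a ^+ 2 * (e \in F)%:R * (-1) ^+ w e.
have -> : \sum_(w' : {ffun E -> bool})
    expR (t * \sum_e (a * (e \in F)%:R * (-1) ^+ w e) * (a * (e \in F)%:R * (-1) ^+ w' e)) =
    \sum_(w' : {ffun E -> bool}) \prod_e expR (x e * (-1) ^+ w' e).
  apply: eq_bigr => w' _; rewrite -expR_sum mulr_sumr; congr expR.
  by apply: eq_bigr => e _; rewrite /x; case: (e \in F); rewrite /= ?mulr0 ?mul0r ?mulr1//; ring.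
rewrite -(bigA_distr_bigA (fun e (b : bool) => expR (x e * (-1) ^+ b))) /=.
apply: (@le_trans _ _ (\prod_e (2 * expR (2 * (t * a ^+ 2) ^+ 2 * (e \in F)%:R)))).
  apply: ler_prod => e _; apply/andP; split; first by apply: sumr_ge0 => b _; exact: expR_ge0.
  have := cosh_le (x e); rewrite ler_pdivrMr// mulrC => /le_trans h.
  rewrite big_bool /= expr1 expr0 mulr1 mulrN1 addrC; apply: h.
  rewrite ler_pM2l// ler_expR /x; case: (e \in F); rewrite /= ?mulr0 ?mul0r ?expr0n ?mulr0//.
  by rewrite !mulr1 exprMn -exprM mulnC exprM sqrrN expr1n expr1n mulr1.
rewrite big_split /= prodr_const card_ffun card_bool natrX -expR_sum.
by rewrite -mulr_sumr -natr_sum -big_mkcond sum1_card.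
Qed.

End rademacher.

Lemma minimax_random_signs (R : realType) (kappa L alpha : R) (gam : nat) :
  0 < kappa -> 1 < L / kappa -> 0 < alpha -> gamma_admissible (L / kappa) gam ->
  exists D0 : nat, forall (n d dstar : nat),
    (0 < n)%N -> (1 <= dstar <= d)%N -> (3 <= 'C(d, dstar))%N -> (D0 < dstar)%N ->
    L / kappa / (alpha * gam%:R) * kappa ^+ 2 <=
      (lattice_count dstar (gam%:R : R))%:R * dstar%:R * ln (d%:R / dstar%:R) / n%:R ^+ 2 ->
    forall (dO : measure_display) (Omega : measurableType dO)
      (P : probability Omega R) (xi : {ffun 'I_d -> int} -> {RV P >-> R}),
    iid_standard_normal xi ->
    ((1 / 2 - alpha)%:E <= minimax_error dstar n kappa L xi)%E.
Proof.
move=> k0 v1 a0 [g0 adm].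
have [z01 h1 cH cm] := theta_moment_z_gamma R g0.
move: adm z01 h1 cH cm; set z := z_gamma _; set h := jacobi_theta z.
set vt := L / kappa in v1 *; move=> adm z01 h1 cH cm.
have g0R : 0 < gam%:R :> R by rewrite ltr0n.
have hm : 0 < h - 1 by lra.
have ghv : gam%:R * h <= vt * (h - 1).
  rewrite -ler_pdivrMr//; apply: le_trans adm.
  by rewrite le_eqVlt; apply/orP; left; apply/eqP; field; rewrite gt_eqF.
have gv : gam%:R <= vt.
  by apply: le_trans adm; rewrite ler_peMr ?(ltW g0R)// lerDl invr_ge0 ltW.
have [N [q [eta [[q0 q1] e0 mean1 mean2]]]] :=
  exists_perturbed_distribution z01 h1 cH cm ghv v1.
have [D0 D0P] := exists_rich_set q0 q1 e0 mean1 mean2.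
exists D0 => n d dstar n0 /andP[s1 sd] N3 D0s hyp dO Omega P xi xi_iid.
have [F [m [m0 countm sumr cardF]]] := D0P _ D0s.
have m0R : 0 < m%:R :> R by rewrite ltr0n.
have n0R : 0 < n%:R :> R by rewrite ltr0n.
have s0R : 0 < dstar%:R :> R by rewrite ltr0n.
set cnt : R := (lattice_count dstar (gam%:R : R))%:R in hyp.
have cnt_le : cnt <= expR (dstar%:R * (ln h - gam%:R * ln z)).
  have /andP[z0 z1] := z01; have := lattice_count_le dstar gam z01.
  rewrite -/h -/cnt -ler_pdivlMr ?exprn_gt0// => /le_trans; apply.
  rewrite le_eqVlt; apply/orP; left; apply/eqP.
  have powE (x : R) k : 0 < x -> x ^+ k = expR (k%:R * ln x).
    by move=> x0; rewrite expRM_natl lnK.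
  rewrite !powE//; last lra.
  by rewrite -expRN -expRD natrM; congr expR; ring.
(* A zero count would make the right side of the assumed inequality 0, whereas its left side is
   positive. *)
have cnt0 : 0 < cnt.
  rewrite lt_neqAle ler0n andbT; apply/eqP => c0; move: hyp; rewrite -c0 !mul0r.
  apply/negP; rewrite -ltNge; apply: mulr_gt0; last by rewrite exprn_gt0.
  by apply: divr_gt0; [exact: lt_trans v1|rewrite mulr_gt0].
pose A : R := Num.sqrt (kappa / m%:R).
have A2 : A ^+ 2 = kappa / m%:R by rewrite sqr_sqrtr// divr_ge0// ltW.
pose freq (e : {ffun 'I_dstar -> 'I_(N.*2.+1)}) : {ffun 'I_dstar -> int} :=
  [ffun i => (e i)%:Z - N%:Z].
have freq_inj : injective freq.
  move=> e e' ee'; apply/ffunP => i; apply/val_inj.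
  have := congr1 (fun f : {ffun 'I_dstar -> int} => f i) ee'.
  by rewrite /= !ffunE => /addIr[].
have freq_sqr e i : (freq e i)%:~R ^+ 2 = (radius (e i) ^ 2)%:R :> R.
  rewrite ffunE natrX -normr_nat natr_absz intr_norm normr_id real_normK ?num_real//.
have freq_eq0 e i : (freq e i != 0) = (radius (e i) != 0%N).
  by rewrite ffunE /radius absz_eq0.
pose c (w : {ffun {ffun 'I_dstar -> 'I_(N.*2.+1)} -> bool}) e : R :=
  A * (e \in F)%:R * (-1) ^+ w e.
have c2 w e : c w e ^+ 2 = (kappa / m%:R) * (e \in F)%:R.
  rewrite /c !exprMn A2 -exprM mulnC exprM sqrrN expr1n expr1n mulr1.
  by case: (e \in F); rewrite ?expr1n ?expr0n.
apply: (@minimax_lower_bound _ _ _ _ _ _ _ _ _ _ _ xi_iid _ _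
  (fun J e => embed J (freq e)) c) => //.
- exact: ltW.
- by rewrite card_ffun expn_gt0 card_bool.
- by move=> J cJ e e' /(embed_inj cJ)/freq_inj.
- by move=> J e j cJ; exact: embed_out.
- move=> J w j cJ /(embed_in cJ)[i ei].
  have -> : \sum_(e | embed J (freq e) j != 0) c w e ^+ 2 =
      kappa / m%:R * #|[set e in F | radius (e i) != 0%N]|%:R.
    rewrite mulr_natr -sumr_const [LHS]big_mkcond [RHS]big_mkcond; apply: eq_bigr => e _.
    by rewrite ei freq_eq0 c2 inE; case: (e \in F); case: (_ != _); rewrite /= ?mulr1 ?mulr0.
  by rewrite countm divfK ?gt_eqF.
- move=> J w j cJ; have [jJ|jJ] := boolP (j \in J); last first.
    rewrite big1 ?ltW// => [|e _]; last by rewrite embed_out// expr0n mul0r.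
    have : 0 < L / kappa * kappa by rewrite mulr_gt0//; rewrite /vt in v1; lra.
    by rewrite divfK// gt_eqF.
  have [i ei] := embed_in cJ jJ.
  have -> : \sum_e (embed J (freq e) j)%:~R ^+ 2 * c w e ^+ 2 =
      kappa / m%:R * \sum_(e in F) (radius (e i) ^ 2)%:R.
    rewrite mulr_sumr [RHS]big_mkcond; apply: eq_bigr => e _.
    by rewrite ei freq_sqr c2; case: (e \in F); rewrite /= ?mulr1 ?mulr0// mulrC.
  apply: (@le_trans _ _ (kappa / m%:R * (vt * m%:R))).
    by rewrite ler_pM2l// divr_gt0.
  by rewrite mulrCA divfK ?gt_eqF// /vt divfK ?gt_eqF.
apply: (le_trans (rademacher_second_moment F n%:R A)).
rewrite ler_wpM2l ?sqr_ge0// ler_expR A2.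
(* The size condition on [F] and the bound on the count give the first inequality; the second
   combines the assumed lower bound, [gam <= vt] and [ln_binomial_ge]. *)
apply: (@le_trans _ _ (n%:R ^+ 2 * kappa ^+ 2 / cnt)).
  have F0 : 0 <= 2 * #|F|%:R :> R by rewrite mulr_ge0.
  have le2 := le_trans (ler_wpM2l F0 cnt_le) cardF.
  have -> : 2 * (n%:R * (kappa / m%:R)) ^+ 2 * #|F|%:R =
      n%:R ^+ 2 * kappa ^+ 2 * (2 * #|F|%:R / m%:R ^+ 2) by field; rewrite gt_eqF.
  apply: ler_wpM2l; first by rewrite mulr_ge0 ?sqr_ge0.
  rewrite -[cnt^-1]mul1r ler_pdivlMr// mulrAC ler_pdivrMr ?exprn_gt0// mul1r.
  exact: le2.
have lnC := ln_binomial_ge R s1 sd.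
apply: (@le_trans _ _ (alpha * (dstar%:R * ln (d%:R / dstar%:R)))); last by rewrite ler_pM2l.
rewrite ler_pdivrMr//.
move: hyp; rewrite ler_pdivlMr ?exprn_gt0// => hyp.
have : 1 <= vt / gam%:R by rewrite ler_pdivlMr// mul1r.
have hypE : vt / (alpha * gam%:R) * kappa ^+ 2 * n%:R ^+ 2 =
    (vt / gam%:R) * (kappa ^+ 2 * n%:R ^+ 2) / alpha.
  by field; rewrite !gt_eqF.
move: hyp; rewrite hypE ler_pdivrMr// => hyp h2.
have nk : 0 <= kappa ^+ 2 * n%:R ^+ 2 by rewrite mulr_ge0 ?sqr_ge0.
have := ler_wpM2r nk h2; lra.
Qed.

Theorem theorem2 (R : realType) (kappa L alpha : R)
    (kappa_gt0 : 0 < kappa) (L_gt0 : 0 < L) (vartheta_gt1 : 1 < L / kappa)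
    (alpha_bounds : 0 < alpha < 1 / 2) :
  (exists D0 : nat,
    forall (gam n d dstar : nat),
    is_gamma_vartheta (L / kappa) gam ->
    (1 <= n)%N -> (1 <= dstar <= d)%N -> (3 <= 'C(d, dstar))%N ->
    (D0 < dstar)%N ->
    (lattice_count dstar (gam%:R : R))%:R * dstar%:R * ln (d%:R / dstar%:R) / n%:R ^+ 2
      >= (L / kappa) / (alpha * gam%:R) * kappa ^+ 2 ->
    forall (dO : measure_display) (Omega : measurableType dO)
      (P : probability Omega R) (xi : {ffun 'I_d -> int} -> {RV P >-> R}),
    iid_standard_normal xi ->
    ((1 / 2 - alpha)%:E <= minimax_error dstar n kappa L xi)%E)
  /\
  (forall (n d dstar : nat),
    (1 <= n)%N -> (1 <= dstar <= d)%N -> (3 <= 'C(d, dstar))%N ->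
    dstar%:R * ln (d%:R / dstar%:R) / n%:R >= kappa / alpha ->
    forall (dO : measure_display) (Omega : measurableType dO)
      (P : probability Omega R) (xi : {ffun 'I_d -> int} -> {RV P >-> R}),
    iid_standard_normal xi ->
    ((1 / 2 - alpha)%:E <= minimax_error dstar n kappa L xi)%E).
Proof.
have /andP[alpha_gt0 _] := alpha_bounds.
split; last first.
  move=> n d dstar n1 sd N3 hyp dO Omega P xi xi_iid.
  apply: minimax_one_frequency => //.
  by move: vartheta_gt1; rewrite ltr_pdivlMr// mul1r => /ltW.
(* The threshold must precede the quantifier on [gam]. Being a maximum, [gam] is unique and can be
   fixed first; if there is none, part (i) is vacuous and any threshold works. *)
have [[gam [adm maxg]]|nog] := pselect (exists gam, is_gamma_vartheta (L / kappa) gam); last first.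
  by exists 0%N => gam n d dstar isg; case: nog; exists gam.
have [D0 D0P] := minimax_random_signs kappa_gt0 vartheta_gt1 alpha_gt0 adm.
exists D0 => gam' n d dstar [adm' maxg'].
have -> : gam' = gam by apply/eqP; rewrite eqn_leq maxg// maxg'.
exact: D0P.
Qed.
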